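(* Let $n \ge 2$ and let $\Omega \subset \mathbb{R}^n$ be an unbounded domain. Let $r_* > 0$ be such that $S_r \cap \Omega \neq \emptyset$ for all $r > r_*$, where $S_r$ is the sphere of radius $r$ centered at the origin. Let $f : \Omega \times [0,\infty) \to \mathbb{R}$ be a function with $f(x,t) > 0$ for all $x \in \Omega$ and all $t > 0$. Suppose there exist real numbers $\sigma > 1$, $\theta > 1$ and non-negative measurable functions $q$ (defined on $(r_*,\infty)$) and $g$ (defined on $(0,\infty)$) with $\inf_K g > 0$ for every compact $K \subset (0,\infty)$, such that $$\inf_{x \in \Omega_{r,\sigma},\ \zeta \in (t/\theta,\, t\theta)} f(x, |x|\zeta) \ge q(r)\, g(t)$$ for all $t > 0$ and $r > r_*$, where $\Omega_{r,\sigma} = \{x \in \Omega : r/\sigma < |x| < r\sigma\}$. Suppose moreover that $$\int_1^\infty (g(t)\,t)^{-1/4}\,dt < \infty \quad\text{and}\quad \int_{r_*}^\infty q(r)\,dr = \infty.$$ Then every non-negative (viscosity) solution $u$ of the problem $$\Delta_\infty u \ge f(x,u) \ \text{in } \Omega, \qquad u|_{\partial\Omega} = 0$$ is identically zero.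
   Context: The $\infty$-Laplacian is $\Delta_\infty u = \sum_{i,j=1}^n \frac{\partial^2 u}{\partial x_i \partial x_j}\frac{\partial u}{\partial x_i}\frac{\partial u}{\partial x_j}$. For $u:\Omega \to \mathbb{R}$ and $x \in \Omega$, the second-order superjet $J^{2,+}_\Omega u(x)$ is the set of pairs $(v,A)$ with $v \in \mathbb{R}^n$ and $A$ a symmetric $n\times n$ matrix such that $u(y) - u(x) \le \langle v, y-x\rangle + \frac12 \langle A(y-x), y-x\rangle + o(|y-x|^2)$ for all $y$ in some neighborhood of $x$. A function $u \ge 0$ on $\overline{\Omega}$ is a non-negative solution of the problem if $u$ is upper semicontinuous on $\overline{\Omega}$ (i.e. $\limsup_{y\to x} u(y) \le u(x)$ for every $x \in \overline\Omega$), $u = 0$ on $\partial\Omega$, and for every $x \in \Omega$ with $J^{2,+}_\Omega u(x) \ne \emptyset$ one has $\langle Av, v\rangle \ge f(x,u(x))$ for all $(v,A) \in J^{2,+}_\Omega u(x)$. If $\Omega = \mathbb{R}^n$ (so $\partial\Omega = \emptyset$), the boundary condition is void. *)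

(* Defs.v *)
From HB Require Import structures.
From mathcomp Require Import all_boot all_order all_algebra.
From mathcomp Require Import all_classical all_reals all_analysis.
Set Implicit Arguments. Unset Strict Implicit. Unset Printing Implicit Defensive.
Import Order.TTheory GRing.Theory Num.Theory.
Import numFieldNormedType.Exports.
Local Open Scope classical_set_scope.
Local Open Scope ring_scope.

Definition dotv {R : realType} {n : nat} (v w : 'rV[R]_n) : R :=
  \sum_(i < n) v ord0 i * w ord0 i.

Definition enorm {R : realType} {n : nat} (v : 'rV[R]_n) : R :=
  Num.sqrt (dotv v v).

(* <A v, v> for a square matrix A (A acting on column vectors). *)
Definition quadf {R : realType} {n : nat} (A : 'M[R]_n) (v : 'rV[R]_n) : R :=
  dotv (v *m A^T) v.

Definition superjet {R : realType} {n : nat} (Omega : set 'rV[R]_n)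
  (u : 'rV[R]_n -> R) (x : 'rV[R]_n) (v : 'rV[R]_n) (A : 'M[R]_n) : Prop :=
  A^T = A /\
  forall eps : R, 0 < eps -> exists delta : R, 0 < delta /\
    forall y, Omega y -> enorm (y - x) < delta ->
      u y - u x <= dotv v (y - x) + 2^-1 * quadf A (y - x)
                   + eps * enorm (y - x) ^+ 2.

(* Upper semicontinuity on closure Omega (u is only defined there). *)
Definition usc_on {R : realType} {n : nat} (D : set 'rV[R]_n)
  (u : 'rV[R]_n -> R) : Prop :=
  forall x, D x -> forall eps : R, 0 < eps -> exists delta : R, 0 < delta /\
    forall y, D y -> enorm (y - x) < delta -> u y <= u x + eps.

Definition bdry {R : realType} {n : nat} (Omega : set 'rV[R]_n) : set 'rV[R]_n :=
  closure Omega `\` interior Omega.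

Definition nonneg_solution {R : realType} {n : nat} (Omega : set 'rV[R]_n)
  (f : 'rV[R]_n -> R -> R) (u : 'rV[R]_n -> R) : Prop :=
  (forall x, closure Omega x -> 0 <= u x) /\
  usc_on (closure Omega) u /\
  (forall x, bdry Omega x -> u x = 0) /\
  (forall x, Omega x -> forall v A, superjet Omega u x v A ->
      f x (u x) <= quadf A v).

(* The real line equipped with the Lebesgue (completed) sigma-algebra. *)
Definition LebR (R : realType) := caratheodory_type (@wlength R idfun)^*%mu.

(* Main.v *)
Require Import Defs.
From HB Require Import structures.
From mathcomp Require Import all_boot all_order all_algebra.
From mathcomp Require Import all_classical all_reals all_analysis.
From mathcomp Require Import measurable_realfun ring lra.
Set Implicit Arguments.
Unset Strict Implicit.
Unset Printing Implicit Defensive.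
Import Order.TTheory GRing.Theory Num.Theory.
Import numFieldNormedType.Exports.
Local Open Scope classical_set_scope.
Local Open Scope ring_scope.

(* Assume that u is positive somewhere and let N r be the maximum of u over the
   ball of radius r. Touching u from above by radial parabolas shows that N is a
   convex viscosity subsolution of N'^2 N'' >= Q(r) g(N/r), where Q(r) is the
   supremum of q near r. Cut the half-line into windows of constant ratio and
   replace r Q(r) by p = min(1, r Q(r)); the integral of p dr/r still diverges.
   As long as m = N/r stays in a level [c, ratio c], the slope satisfies
   N'^3 >~ g(c) tau, with tau the part of the integral of p dr/r spent in the
   level, and once N' >= 2 ratio c the supporting line expels m from the level in
   a time of order c / N'. Hence tau <~ y^4 + y with y = c (g(c) c)^(-1/4). These
   y are summable over geometric levels by the integrability condition on g, so
   the total time, the integral of p dr/r, would be finite. *)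

Section Euclidean.
Context {R : realType} {n : nat}.
Implicit Types (v w x y : 'rV[R]_n) (a b : R).

Lemma dotvC v w : dotv v w = dotv w v.
Proof. by apply: eq_bigr => i _; rewrite mulrC. Qed.

Lemma dotvDl v w x : dotv (v + w) x = dotv v x + dotv w x.
Proof. by rewrite -big_split; apply: eq_bigr => i _; rewrite mxE mulrDl. Qed.

Lemma dotvZl a v w : dotv (a *: v) w = a * dotv v w.
Proof. by rewrite mulr_sumr; apply: eq_bigr => i _; rewrite mxE mulrA. Qed.

Lemma dotvDr v w x : dotv x (v + w) = dotv x v + dotv x w.
Proof. by rewrite dotvC dotvDl !(dotvC x). Qed.

Lemma dotvZr a v w : dotv v (a *: w) = a * dotv v w.
Proof. by rewrite dotvC dotvZl dotvC. Qed.

Lemma dot0v v : dotv 0 v = 0.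
Proof. by rewrite -(scale0r 0) dotvZl mul0r. Qed.

Lemma dotvv_ge0 v : 0 <= dotv v v.
Proof. by apply: sumr_ge0 => i _; rewrite -expr2 sqr_ge0. Qed.

Lemma enorm_ge0 v : 0 <= enorm v.
Proof. exact: sqrtr_ge0. Qed.

Lemma sqr_enorm v : enorm v ^+ 2 = dotv v v.
Proof. by rewrite sqr_sqrtr // dotvv_ge0. Qed.

Lemma normr_coord_le_enorm v i : `|v ord0 i| <= enorm v.
Proof.
rewrite -sqrtr_sqr ler_sqrt ?dotvv_ge0// /dotv (bigD1 i) //= -expr2 lerDl.
by apply: sumr_ge0 => j _; rewrite -expr2 sqr_ge0.
Qed.

Lemma dotvv_eq0 v : (dotv v v == 0) = (v == 0).
Proof.
apply/eqP/eqP => [v0|->]; last exact: dot0v.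
apply/rowP => i; apply/eqP; rewrite mxE -normr_eq0 eq_le normr_ge0 andbT.
by rewrite (le_trans (normr_coord_le_enorm v i))// /enorm v0 sqrtr0.
Qed.

Lemma sqr_dotv_le v w : dotv v w ^+ 2 <= dotv v v * dotv w w.
Proof.
have [->|w0] := eqVneq w 0; first by rewrite dotvC !dot0v expr0n mulr0.
have ww_gt0 : 0 < dotv w w by rewrite lt_neqAle eq_sym dotvv_eq0 w0 dotvv_ge0.
rewrite -subr_ge0 -(pmulr_rge0 _ ww_gt0).
have := dotvv_ge0 (dotv w w *: v + (- dotv v w) *: w).
rewrite !(dotvDl, dotvDr, dotvZl, dotvZr) (dotvC w v).
by congr (_ <= _); ring.
Qed.

Lemma normr_dotv_le v w : `|dotv v w| <= enorm v * enorm w.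
Proof.
rewrite -ler_sqr ?nnegrE ?mulr_ge0 ?enorm_ge0//.
by rewrite exprMn !sqr_enorm real_normK ?num_real// sqr_dotv_le.
Qed.

Lemma sqr_enormD v w :
  enorm (v + w) ^+ 2 = enorm v ^+ 2 + 2 * dotv v w + enorm w ^+ 2.
Proof. by rewrite !sqr_enorm !(dotvDl, dotvDr) (dotvC w v); ring. Qed.

Lemma ler_enormD v w : enorm (v + w) <= enorm v + enorm w.
Proof.
rewrite -ler_sqr ?nnegrE ?addr_ge0 ?enorm_ge0// sqr_enormD.
have := le_trans (ler_norm _) (normr_dotv_le v w); lra.
Qed.

Lemma enormN v : enorm (- v) = enorm v.
Proof. by rewrite /enorm -scaleN1r dotvZl dotvZr mulrA mulrNN !mul1r. Qed.

Lemma enorm_distrC v w : enorm (v - w) = enorm (w - v).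
Proof. by rewrite -enormN opprB. Qed.

Lemma ler_dist_enorm v w : `|enorm v - enorm w| <= enorm (v - w).
Proof.
have := ler_enormD (v - w) w; have := ler_enormD (w - v) v.
by rewrite !subrK (enorm_distrC w v) ler_norml => *; apply/andP; split; lra.
Qed.

Lemma mx_norm_le_enorm v : `|v| <= enorm v.
Proof.
rewrite [leLHS]/Num.norm /= mx_normrE; apply/bigmax_leP; split.
  exact: enorm_ge0.
by move=> [i j] _ /=; rewrite ord1 normr_coord_le_enorm.
Qed.

Lemma enorm_le_mx_norm v : enorm v <= n%:R * `|v|.
Proof.
rewrite -ler_sqr ?nnegrE ?mulr_ge0 ?enorm_ge0// sqr_enorm exprMn.
have coord_le i : `|v ord0 i| <= `|v|.
  rewrite [leRHS]/Num.norm /= mx_normrE.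
  by apply/bigmax_geP; right => /=; exists (ord0, i).
apply: (@le_trans _ _ (\sum_(i < n) `|v| ^+ 2)).
  apply: ler_sum => i _; rewrite -expr2 -[leLHS]real_normK ?num_real//.
  by rewrite ler_sqr ?nnegrE.
rewrite sumr_const card_ord -[leLHS]mulr_natl ler_wpM2r ?sqr_ge0//.
by rewrite -natrX ler_nat; case: (n) => // k; rewrite expnS leq_pmulr// expn1.
Qed.

Lemma nbhs_enormP x (P : set 'rV[R]_n) :
  (\forall y \near x, P y) <->
  exists2 d, 0 < d & forall y, enorm (y - x) < d -> P y.
Proof.
split=> [/nbhs_normP[d /= d0 xP]|[d d0 xP]].
  exists d => // y yx; apply: xP; rewrite /= distrC.
  exact: le_lt_trans (mx_norm_le_enorm _) yx.
have n1 : 0 < n.+1%:R :> R by rewrite ltr0n.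
apply/nbhs_normP; exists (d / n.+1%:R); first by rewrite /= divr_gt0.
move=> y /=; rewrite distrC ltr_pdivlMr// mulrC => yx; apply: xP.
apply: le_lt_trans yx; apply: le_trans (enorm_le_mx_norm _) _.
by rewrite ler_wpM2r// ler_nat.
Qed.

Lemma enorm_continuous : continuous (@enorm R n).
Proof.
move=> x; apply/(@cvgrPdist_lt _ _ _ (nbhs x) (nbhs_filter x)) => e e0.
apply/nbhs_enormP; exists e => // y yx.
by rewrite distrC (le_lt_trans (ler_dist_enorm _ _)).
Qed.

Lemma compact_annulus (D : set 'rV[R]_n) a b :
  compact (closure D `&` [set x | a <= enorm x <= b]).
Proof.
apply: bounded_closed_compact.
  exists b; split; first exact: num_real.
  move=> M bM x [_ /= /andP[_ xb]].
  exact: le_trans (mx_norm_le_enorm x) (le_trans xb (ltW bM)).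
apply: closedI; first exact: closed_closure.
rewrite (_ : [set _ | _] = @enorm R n @^-1` `[a, b]); last first.
  by apply/seteqP; split=> x /=; rewrite in_itv.
by apply: closed_comp => [x _|]; [exact: enorm_continuous|exact: itv_closed].
Qed.

Lemma usc_on_compact_max (K : set 'rV[R]_n) (w : 'rV[R]_n -> R) :
  compact K -> K !=set0 -> usc_on K w ->
  exists2 x, K x & forall y, K y -> w y <= w x.
Proof.
move=> cK [z Kz] uscw.
pose superlevel y := [set x | K x /\ w y <= w x].
pose F := filter_from K superlevel.
have FF : ProperFilter F.
  apply: filter_from_proper; last by move=> y Ky; exists y.
  apply: filter_from_filter; first by exists z.
  move=> i j Ki Kj; have [wij|/ltW wji] := leP (w i) (w j).
    by exists j => // x [Kx jx]; split; split=> //; exact: le_trans wij jx.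
  by exists i => // x [Kx ix]; split; split=> //; exact: le_trans wji ix.
have FK : F K by exists z => // x [].
have [p [Kp clp]] := cK F FF FK.
exists p => // y Ky; apply/ler_addgt0Pr => e e0.
have [d [d0 w_le]] := uscw p Kp e e0.
have Fy : F (superlevel y) by exists y.
have near_p : \forall x \near p, enorm (x - p) < d.
  by apply/nbhs_enormP; exists d.
have [x [[Kx yx] xp]] := clp _ _ Fy near_p.
exact: le_trans yx (w_le _ Kx xp).
Qed.

Lemma usc_onS (D E : set 'rV[R]_n) (w : 'rV[R]_n -> R) :
  D `<=` E -> usc_on E w -> usc_on D w.
Proof.
move=> DE uscw x Dx e e0; have [d [d0 w_le]] := uscw x (DE _ Dx) e e0.
by exists d; split=> // y /DE; exact: w_le.
Qed.

Lemma usc_onB (D : set 'rV[R]_n) (w psi : 'rV[R]_n -> R) :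
  continuous psi -> usc_on D w -> usc_on D (w \- psi).
Proof.
move=> cpsi uscw x Dx e e0; have e2 : 0 < e / 2 by rewrite divr_gt0.
have [d [d0 w_le]] := uscw x Dx _ e2.
have /cvgrPdist_lt/(_ _ e2)/nbhs_enormP[d' d'0 psi_near] := cpsi x.
exists (Num.min d d'); split; first by rewrite lt_min d0.
move=> y Dy; rewrite lt_min => /andP[/(w_le y Dy) wy /psi_near].
by rewrite ltr_norml /= => /andP[_ ?]; lra.
Qed.

End Euclidean.

Section Superjets.
Context {R : realType} {n : nat}.
Implicit Types (D : set 'rV[R]_n) (u phi : 'rV[R]_n -> R) (x y v : 'rV[R]_n).

Lemma quadf0 v : quadf 0 v = 0.
Proof. by rewrite /quadf trmx0 mulmx0 dot0v. Qed.

Lemma superjet_touching D u phi x v A d : 0 < d ->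
  (forall y, D y -> enorm (y - x) < d -> u y - u x <= phi y - phi x) ->
  superjet D phi x v A -> superjet D u x v A.
Proof.
move=> d0 touch [symA phi_jet]; split=> // e e0.
have [d' [d'0 phi_le]] := phi_jet e e0.
exists (Num.min d d'); split; first by rewrite lt_min d0.
move=> y Dy; rewrite lt_min => /andP[yd yd'].
exact: le_trans (touch y Dy yd) (phi_le y Dy yd').
Qed.

Lemma superjet_cst D (a : R) x : superjet D (cst a) x 0 0.
Proof.
split=> [|e e0]; first exact: trmx0.
exists 1; split=> // y _ _; rewrite quadf0 dot0v subrr mulr0 !add0r.
by rewrite mulr_ge0 ?sqr_ge0// ltW.
Qed.

Definition radial_gradient (beta : R) x : 'rV[R]_n := (beta / enorm x) *: x.

Definition radial_hessian (beta lam : R) x : 'M[R]_n :=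
  (beta / enorm x)%:M + ((lam - beta / enorm x) / enorm x ^+ 2) *: (x^T *m x).

Lemma quadf_radial_hessian beta lam x v :
  quadf (radial_hessian beta lam x) v = beta / enorm x * enorm v ^+ 2 +
    (lam - beta / enorm x) / enorm x ^+ 2 * dotv x v ^+ 2.
Proof.
have vx : v *m x^T = (dotv x v)%:M.
  apply/rowP => i; rewrite ord1 !mxE eqxx mulr1n dotvC.
  by apply: eq_bigr => j _; rewrite mxE.
rewrite /quadf [(_ + _)^T]raddfD /= tr_scalar_mx linearZ /= trmx_mul trmxK.
rewrite mulmxDr mul_mx_scalar -scalemxAr mulmxA vx mul_scalar_mx.
by rewrite dotvDl !dotvZl -expr2 (sqr_enorm v).
Qed.

Lemma quadf_radial beta lam x : 0 < enorm x ->
  quadf (radial_hessian beta lam x) (radial_gradient beta x) = beta ^+ 2 * lam.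
Proof.
move=> x0; rewrite quadf_radial_hessian sqr_enorm !(dotvZl, dotvZr) -sqr_enorm.
by field; rewrite gt_eqF.
Qed.

Lemma sqr_enorm_increment x y :
  (enorm y - enorm x) ^+ 2 + 2 * enorm x * (enorm y - enorm x) =
  2 * dotv x (y - x) + enorm (y - x) ^+ 2.
Proof.
have yE : enorm y ^+ 2 = enorm x ^+ 2 + 2 * dotv x (y - x) + enorm (y - x) ^+ 2.
  by rewrite -sqr_enormD addrC subrK.
by ring: yE.
Qed.

(* The difference of the two squares factors: |y| - |x| exceeds its linear part
   by at most |y - x|^2 / (2|x|), and both terms are at most |y - x|. *)
Lemma sqr_enorm_increment_error x y : 0 < enorm x ->
  `|(enorm y - enorm x) ^+ 2 - (dotv x (y - x) / enorm x) ^+ 2| <=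
  enorm (y - x) ^+ 3 / enorm x.
Proof.
move=> x0; have del_le := ler_dist_enorm y x.
have := sqr_enorm_increment x y; have := normr_dotv_le x (y - x).
set r := enorm x in x0 *; set t := enorm (y - x) in del_le *.
set p := dotv _ _; set del := enorm y - r in del_le *; move=> p_le delE.
have t0 : 0 <= t by exact: enorm_ge0.
have lin_le : `|p / r| <= t.
  by rewrite normrM normfV (gtr0_norm x0) ler_pdivrMr// mulrC.
have diffE : del - p / r = (t ^+ 2 - del ^+ 2) / (2 * r).
  by rewrite (_ : t ^+ 2 = del ^+ 2 + 2 * r * del - 2 * p);
    [field; rewrite gt_eqF|lra].
have diff_le : `|del - p / r| <= t ^+ 2 / (2 * r).
  have del2_le : del ^+ 2 <= t ^+ 2.
    by rewrite -real_normK ?num_real// ler_sqr ?nnegrE.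
  have r2 : 0 < 2 * r by rewrite mulr_gt0.
  rewrite diffE normrM normfV (gtr0_norm r2) ler_wpM2r ?invr_ge0 ?(ltW r2)//.
  by rewrite ger0_norm ?subr_ge0// gerBl sqr_ge0.
have sum_le : `|del + p / r| <= 2 * t.
  by apply: le_trans (ler_normD _ _) _; lra.
rewrite subr_sqr normrM.
apply: le_trans (ler_pM (normr_ge0 _) (normr_ge0 _) diff_le sum_le) _.
by rewrite le_eqVlt; apply/orP; left; apply/eqP; field; rewrite gt_eqF.
Qed.

Lemma radial_parabola_le_taylor beta lam x y : 0 < enorm x ->
  beta * (enorm y - enorm x) + 2^-1 * lam * (enorm y - enorm x) ^+ 2 <=
  dotv (radial_gradient beta x) (y - x)
    + 2^-1 * quadf (radial_hessian beta lam x) (y - x)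
    + 2^-1 * `|lam - beta / enorm x| * (enorm (y - x) ^+ 3 / enorm x).
Proof.
move=> x0; rewrite quadf_radial_hessian dotvZl.
have := sqr_enorm_increment_error y x0; have := sqr_enorm_increment x y.
set r := enorm x in x0 *; set t := enorm (y - x); set p := dotv _ _.
set del := enorm y - r => delE sqr_err.
have -> : beta * del + 2^-1 * lam * del ^+ 2 =
    beta / r * p
    + 2^-1 * (beta / r * t ^+ 2 + (lam - beta / r) / r ^+ 2 * p ^+ 2)
    + 2^-1 * (lam - beta / r) * (del ^+ 2 - (p / r) ^+ 2).
  rewrite (_ : t ^+ 2 = del ^+ 2 + 2 * r * del - 2 * p); last lra.
  by field; rewrite gt_eqF.
rewrite lerD2l; apply: le_trans (ler_norm _) _.
rewrite !normrM (@ger0_norm _ 2^-1) ?invr_ge0//.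
by rewrite ler_wpM2l// mulr_ge0.
Qed.

Lemma superjet_radial D (phi : R -> R) (beta lam : R) x : 0 < enorm x ->
  (forall eps, 0 < eps -> exists2 d, 0 < d & forall s, `|s - enorm x| < d ->
     phi s - phi (enorm x) <= beta * (s - enorm x)
       + 2^-1 * lam * (s - enorm x) ^+ 2 + eps * (s - enorm x) ^+ 2) ->
  superjet D (phi \o enorm) x
    (radial_gradient beta x) (radial_hessian beta lam x).
Proof.
move=> x0 phi_expansion; split=> [|eps eps0].
  by rewrite [LHS]raddfD /= tr_scalar_mx linearZ /= trmx_mul trmxK.
have eps2 : 0 < eps / 2 by rewrite divr_gt0.
have [d d0 phi_le] := phi_expansion _ eps2.
pose K := 2^-1 * `|lam - beta / enorm x| / enorm x.
have K1 : 0 < K + 1 by rewrite ltr_wpDl// !mulr_ge0 ?invr_ge0 ?(ltW x0).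
exists (Num.min d (eps / 2 / (K + 1))); split.
  by rewrite lt_min d0 divr_gt0.
move=> y _; rewrite lt_min => /andP[yd]; rewrite ltr_pdivlMr// => yK.
have del_le := ler_dist_enorm y x.
have := phi_le _ (le_lt_trans del_le yd).
have := radial_parabola_le_taylor beta lam y x0.
have t0 := enorm_ge0 (y - x).
have del2_le : (enorm y - enorm x) ^+ 2 <= enorm (y - x) ^+ 2.
  by rewrite -real_normK ?num_real// ler_sqr ?nnegrE.
have := ler_wpM2l (ltW eps2) del2_le.
have : K * enorm (y - x) * enorm (y - x) ^+ 2 <= eps / 2 * enorm (y - x) ^+ 2.
  by rewrite ler_wpM2r ?sqr_ge0//; lra.
rewrite (_ : K * _ * _ = 2^-1 * `|lam - beta / enorm x| *
    (enorm (y - x) ^+ 3 / enorm x)); last by rewrite /K; field; rewrite gt_eqF.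
by rewrite /comp; lra.
Qed.

End Superjets.

Section ChordSlopes.
Context {R : realType}.
Implicit Types (N F : R -> R) (ra a b c r x y lam : R).

Definition chord_slope N a b := (N b - N a) / (b - a).

Definition right_deriv N r :=
  inf [set chord_slope N r y | y in [set y | r < y]].

Definition chord_parabola N lam a b y :=
  N a + chord_slope N a b * (y - a) - lam / 2 * ((y - a) * (b - y)).

Lemma chord_slopeM N a b : a < b -> chord_slope N a b * (b - a) = N b - N a.
Proof. by move=> ab; rewrite /chord_slope divfK// subr_eq0 gt_eqF. Qed.

Lemma chord_parabola_left N lam a b : chord_parabola N lam a b a = N a.
Proof. by rewrite /chord_parabola; ring. Qed.

Lemma chord_parabola_right N lam a b : a < b ->
  chord_parabola N lam a b b = N b.
Proof. by move=> ab; rewrite /chord_parabola chord_slopeM//; ring. Qed.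

Lemma chord_parabola_expansion N lam a b r y :
  chord_parabola N lam a b y - chord_parabola N lam a b r =
  (chord_slope N a b + lam / 2 * (2 * r - a - b)) * (y - r)
    + 2^-1 * lam * (y - r) ^+ 2.
Proof. by rewrite /chord_parabola; field. Qed.

Lemma chord_parabola_continuous N lam a b :
  continuous (chord_parabola N lam a b).
Proof.
pose p : {poly R} := (N a)%:P + chord_slope N a b *: ('X - a%:P)
   - (lam / 2) *: (('X - a%:P) * (b%:P - 'X)).
rewrite (_ : chord_parabola N lam a b = horner p).
  exact: continuous_horner.
apply/funext => r; rewrite /chord_parabola /p.
by rewrite !(hornerD, hornerN, hornerZ, hornerM, hornerC, hornerX).
Qed.

(* The viscosity form of N'^2 N'' >= F: the chord slope plus lam (b - a) / 2 is
   the largest slope of the parabola of curvature lam through the end points. *)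
Definition comparison_with_parabolas N F ra := forall a b lam,
  ra <= a -> a < b -> 0 <= lam ->
  (forall r, a < r < b ->
     (chord_slope N a b + lam * (b - a) / 2) ^+ 2 * lam <= F r) ->
  forall y, a <= y <= b -> N y <= chord_parabola N lam a b y.

End ChordSlopes.

Section IncreasingConvex.
Context {R : realType} (N : R -> R) (ra : R).
Implicit Types (a b c r s x y C : R).
Hypothesis N_lt : forall r s, ra <= r -> r < s -> N r < N s.
Hypothesis N_convex : forall a b y, ra <= a -> a < b -> a <= y <= b ->
  N y <= N a + chord_slope N a b * (y - a).

Lemma chord_slope_ge0 a b : ra <= a -> a < b -> 0 <= chord_slope N a b.
Proof. by move=> raa ab; rewrite divr_ge0// subr_ge0 ltW// N_lt. Qed.

Lemma chord_slope_le a b c : ra <= a -> a < b -> b < c ->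
  chord_slope N a b <= chord_slope N b c.
Proof.
move=> raa ab bc; have ac := lt_trans ab bc.
have := N_convex raa ac (y := b); rewrite (ltW ab) (ltW bc) => /(_ isT).
have := chord_slopeM N ac => acE b_le.
apply: (@le_trans _ _ (chord_slope N a c)).
  by rewrite ler_pdivrMr ?subr_gt0//; lra.
by rewrite ler_pdivlMr ?subr_gt0//; lra.
Qed.

Lemma right_deriv_le_chord_slope r y : ra <= r -> r < y ->
  right_deriv N r <= chord_slope N r y.
Proof.
move=> rar ry; apply: ge_inf; last by exists y.
by exists 0 => _ [t /= rt <-]; exact: chord_slope_ge0.
Qed.

Lemma chord_slope_le_right_deriv x r : ra <= x -> x < r ->
  chord_slope N x r <= right_deriv N r.
Proof.
move=> rax xr; apply: lb_le_inf.
  by exists (chord_slope N r (r + 1)), (r + 1) => //=; rewrite ltrDl.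
by move=> _ [y /= ry <-]; exact: chord_slope_le.
Qed.

Lemma right_deriv_le x y : ra <= x -> x <= y ->
  right_deriv N x <= right_deriv N y.
Proof.
move=> rax; rewrite le_eqVlt => /predU1P[->//|xy].
apply: le_trans (right_deriv_le_chord_slope rax xy) _.
exact: chord_slope_le_right_deriv.
Qed.

Lemma right_deriv_gt0 r : ra < r -> 0 < right_deriv N r.
Proof.
move=> rar; apply: lt_le_trans (chord_slope_le_right_deriv (lexx _) rar).
by rewrite divr_gt0// subr_gt0// N_lt.
Qed.

Lemma cube_right_deriv_le x y : ra < x -> x <= y ->
  right_deriv N x ^+ 3 <= right_deriv N y ^+ 3.
Proof.
move=> rax xy; have D0 := right_deriv_gt0 rax.
have xyD := right_deriv_le (ltW rax) xy.
by rewrite lerXn2r ?nnegrE ?(ltW D0)// (le_trans _ xyD)// ltW.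
Qed.

Lemma supporting_line r y : ra <= r -> r <= y ->
  N r + right_deriv N r * (y - r) <= N y.
Proof.
move=> rar; rewrite le_eqVlt => /predU1P[<-|ry].
  by rewrite subrr mulr0 addr0.
have := right_deriv_le_chord_slope rar ry.
by rewrite ler_pdivlMr ?subr_gt0//; lra.
Qed.

Lemma le_right_deriv_increment x r : ra <= x -> x <= r ->
  N r - N x <= right_deriv N r * (r - x).
Proof.
move=> rax; rewrite le_eqVlt => /predU1P[<-|xr]; first by rewrite !subrr mulr0.
by have := chord_slope_le_right_deriv rax xr; rewrite ler_pdivrMr ?subr_gt0.
Qed.

Hypothesis ra_ge0 : 0 <= ra.

Lemma ratio_lower_bound r0 : ra < r0 -> 0 < N r0 ->
  exists2 c, 0 < c & forall r, r0 <= r -> c <= N r / r.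
Proof.
move=> rar0 N0; have r0_gt0 := le_lt_trans ra_ge0 rar0.
have D0 := right_deriv_gt0 rar0.
pose c := Num.min (N r0 / r0) (right_deriv N r0).
exists c; first by rewrite lt_min divr_gt0.
move=> r r0r; rewrite ler_pdivlMr ?(lt_le_trans r0_gt0)//.
apply: le_trans (supporting_line (ltW rar0) r0r).
have : c * r0 <= N r0 by rewrite -ler_pdivlMr// ge_min lexx.
have : c * (r - r0) <= right_deriv N r0 * (r - r0).
  by rewrite ler_wpM2r ?subr_ge0// ge_min lexx orbT.
lra.
Qed.

Lemma right_deriv_le_ratio r C : ra < r -> 0 <= N r ->
  N (2 * r) <= C * (2 * r) -> right_deriv N r <= 2 * C.
Proof.
move=> rar N0 N2; have r_gt0 := le_lt_trans ra_ge0 rar.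
have r2r : r <= 2 * r by lra.
by rewrite -(ler_pM2r r_gt0); have := supporting_line (ltW rar) r2r; lra.
Qed.

Lemma ratio_le_right_deriv r0 r : ra < r0 -> r0 < r -> N r0 / r0 < N r / r ->
  N r / r <= right_deriv N r.
Proof.
move=> rar0 r0r; have r0_gt0 := le_lt_trans ra_ge0 rar0.
have r_gt0 := lt_trans r0_gt0 r0r.
have NrE : N r = N r / r * r by rewrite divfK// gt_eqF.
rewrite ltr_pdivrMr// => ratio_lt.
have D_ge := le_right_deriv_increment (ltW rar0) (ltW r0r).
rewrite -(@ler_pM2r _ (r - r0)) ?subr_gt0//.
by move: NrE ratio_lt; set m := N r / r; lra.
Qed.

Lemma ratio_nondecreasing r x y : ra < r -> N r / r <= right_deriv N r ->
  r <= x -> x <= y -> N x / x <= N y / y.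
Proof.
move=> rar; have r_gt0 := le_lt_trans ra_ge0 rar.
rewrite ler_pdivrMr// => rD rx xy; have rax := lt_le_trans rar rx.
have x_gt0 := lt_le_trans r_gt0 rx; have y_gt0 := lt_le_trans x_gt0 xy.
have xD : N x / x <= right_deriv N x.
  rewrite ler_pdivrMr//; have := le_right_deriv_increment (ltW rar) rx.
  have : right_deriv N r * r <= right_deriv N x * r.
    by rewrite ler_wpM2r ?(ltW r_gt0)// right_deriv_le// ltW.
  lra.
rewrite ler_pdivlMr//; apply: le_trans (supporting_line (ltW rax) xy).
have NxE : N x = N x / x * x by rewrite divfK// gt_eqF.
have : N x / x * (y - x) <= right_deriv N x * (y - x).
  by rewrite ler_wpM2r ?subr_ge0.
by move: NxE; set m := N x / x; lra.
Qed.

End IncreasingConvex.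

Section SubsolutionSlope.
Context {R : realType} (N F : R -> R) (ra : R).
Hypothesis N_lt : forall r s, ra <= r -> r < s -> N r < N s.
Hypothesis F_ge0 : forall r, ra <= r -> 0 <= F r.
Hypothesis N_sub : comparison_with_parabolas N F ra.

Lemma subsolution_convex a b y : ra <= a -> a < b -> a <= y <= b ->
  N y <= N a + chord_slope N a b * (y - a).
Proof.
move=> raa ab yab; have := N_sub raa ab (lexx 0) _ yab.
rewrite /chord_parabola !mul0r subr0; apply=> // r /andP[ar _].
by rewrite mulr0 F_ge0// (le_trans raa)// ltW.
Qed.

Let D_le_slope := right_deriv_le_chord_slope N_lt.
Let slope_le_D := chord_slope_le_right_deriv subsolution_convex.

Lemma right_deriv_gain a b lam : ra <= a -> a < b -> 0 <= lam ->
  (forall r, a < r < b ->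
     (chord_slope N a b + lam * (b - a) / 2) ^+ 2 * lam <= F r) ->
  right_deriv N a + lam * (b - a) / 2 <= right_deriv N b.
Proof.
move=> raa ab lam0 F_ge; pose y := (a + b) / 2.
have ay : a < y by rewrite /y; lra.
have yb : y < b by rewrite /y; lra.
have := N_sub raa ab lam0 F_ge (introT andP (conj (ltW ay) (ltW yb))).
have abE := chord_slopeM N ab.
have -> : chord_parabola N lam a b y =
    N a + (chord_slope N a b - lam * (b - a) / 4) * (y - a).
  by rewrite /chord_parabola /y; field.
have baE : b - a = 2 * (y - a) by rewrite /y; lra.
have byE : b - y = y - a by rewrite /y; lra.
rewrite baE in abE *; move=> Ny.
have left_le : right_deriv N a <= chord_slope N a b - lam * (2 * (y - a)) / 4.
  apply: le_trans (D_le_slope raa ay) _.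
  by rewrite ler_pdivrMr ?subr_gt0//; lra.
have right_ge : chord_slope N a b + lam * (2 * (y - a)) / 4 <= right_deriv N b.
  apply: le_trans (slope_le_D (le_trans raa (ltW ay)) yb).
  by rewrite ler_pdivlMr ?subr_gt0// byE; lra.
lra.
Qed.

(* Integrated form of (N'^3)' >= 3 F. *)
Lemma cube_right_deriv_gain a b c : ra < a -> a < b -> 0 <= c ->
  (forall r, a < r < b -> c <= F r) ->
  c * (b - a) / 8 <= right_deriv N b ^+ 3 - right_deriv N a ^+ 3.
Proof.
move=> raa ab c0 F_ge; have h0 : 0 < b - a by rewrite subr_gt0.
have D0 := right_deriv_gt0 N_lt subsolution_convex.
have := D0 a raa; have := D0 b (lt_trans raa ab).
set d := right_deriv N b; set x := right_deriv N a => d0 x0.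
have gain lam : 0 <= lam -> lam * (b - a) <= 2 * d -> 4 * d ^+ 2 * lam <= c ->
    x + lam * (b - a) / 2 <= d.
  move=> lam0 lam_d lam_c.
  apply: right_deriv_gain; rewrite ?(ltW raa)// => r rab.
  apply: le_trans (F_ge r rab); apply: le_trans lam_c; rewrite ler_wpM2r//.
  have := slope_le_D (ltW raa) ab; have := chord_slope_ge0 N_lt (ltW raa) ab.
  have lamh : 0 <= lam * (b - a) by rewrite mulr_ge0// ltW.
  rewrite (_ : 4 * d ^+ 2 = (2 * d) ^+ 2); last by ring.
  by rewrite -/d => *; rewrite ler_sqr ?nnegrE; lra.
have d2 : 0 < 4 * d ^+ 2 by rewrite mulr_gt0// exprn_gt0.
pose lam := c / (4 * d ^+ 2).
have lam0 : 0 <= lam by rewrite divr_ge0// ltW.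
have lam_c : 4 * d ^+ 2 * lam = c by rewrite mulrC divfK// gt_eqF.
have [lam_d|lam_d] := leP (lam * (b - a)) (2 * d); last first.
  have : 2 * d / (b - a) <= lam by rewrite ler_pdivrMr// ltW.
  move/(ler_wpM2l (ltW d2)); rewrite lam_c => /(gain (2 * d / (b - a))).
  by rewrite divfK ?gt_eqF// divr_ge0 ?mulr_ge0 ?(ltW d0) ?(ltW h0)//; lra.
have dx : x + lam * (b - a) / 2 <= d by apply: gain; rewrite ?lam_c.
have lamh : 0 <= lam * (b - a) by rewrite mulr_ge0// ltW.
have : d ^+ 2 * (lam * (b - a) / 2) <= d ^+ 2 * (d - x).
  by rewrite ler_wpM2l ?sqr_ge0//; lra.
have : 0 <= x * (d - x) * (d + x) by rewrite !mulr_ge0//; lra.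
by rewrite -lam_c; lra.
Qed.

End SubsolutionSlope.

Section MaximumOnBalls.
Context {R : realType} {n : nat} (Omega : set 'rV[R]_n).
Context (f : 'rV[R]_n -> R -> R) (u : 'rV[R]_n -> R).
Implicit Types (x y : 'rV[R]_n) (r s : R).
Hypothesis f_gt0 : forall x t, Omega x -> 0 < t -> 0 < f x t.
Hypothesis u_sol : nonneg_solution Omega f u.

Lemma solution_gt0_mem x : closure Omega x -> 0 < u x -> Omega x.
Proof.
move=> clx ux; apply: contrapT => nOx; have [_ [_ [u0 _]]] := u_sol.
have /u0 ux0 : bdry Omega x by split=> // /interior_subset.
by rewrite ux0 ltxx in ux.
Qed.

Lemma solution_local_max_le0 x d : Omega x -> 0 < d ->
  (forall y, Omega y -> enorm (y - x) < d -> u y <= u x) -> u x <= 0.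
Proof.
move=> Ox d0 u_le; have [_ [_ [_ u_jet]]] := u_sol.
rewrite leNgt; apply/negP => /(f_gt0 Ox); rewrite ltNge => /negP; apply.
rewrite -[leRHS](quadf0 (0 : 'rV_n)); apply: (u_jet x Ox).
apply: (superjet_touching d0 _ (superjet_cst Omega 0 x)) => y Oy yx.
by rewrite subrr subr_le0 u_le.
Qed.

Lemma solution_radial_touching x d (phi : R -> R) (beta lam : R) :
  Omega x -> 0 < enorm x -> 0 < d ->
  (forall y, Omega y -> enorm (y - x) < d ->
     u y - u x <= phi (enorm y) - phi (enorm x)) ->
  (forall s, phi s - phi (enorm x) =
     beta * (s - enorm x) + 2^-1 * lam * (s - enorm x) ^+ 2) ->
  f x (u x) <= beta ^+ 2 * lam.
Proof.
move=> Ox x0 d0 touch phiE; have [_ [_ [_ u_jet]]] := u_sol.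
rewrite -(quadf_radial _ _ x0); apply: (u_jet x Ox).
apply: (superjet_touching (phi := phi \o @enorm R n) d0 touch).
apply: superjet_radial => // eps eps0; exists 1 => // s _.
by rewrite phiE lerDl mulr_ge0 ?sqr_ge0// ltW.
Qed.

Definition ballmax r :=
  sup [set u x | x in closure Omega `&` [set x | enorm x <= r]].

Definition maximizer r :=
  [set x | [/\ Omega x, enorm x = r & u x = ballmax r]].

Definition source r := inf [set f x (u x) | x in maximizer r].

Context (z : 'rV[R]_n).
Hypotheses (clz : closure Omega z) (uz : 0 < u z).

Lemma ballmax_attained r : enorm z <= r ->
  exists x, [/\ closure Omega x, enorm x <= r, u x = ballmax r &
    forall y, closure Omega y -> enorm y <= r -> u y <= u x].
Proof.
move=> zr; have [_ [uscu _]] := u_sol.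
pose K := closure Omega `&` [set x | 0 <= enorm x <= r].
have KE : K = closure Omega `&` [set x | enorm x <= r].
  by congr (_ `&` _); apply: eq_set => x; rewrite enorm_ge0.
have Kz : K z by rewrite KE.
have uscK : usc_on K u by apply: usc_onS uscu => x [].
have cK : compact K by exact: compact_annulus.
have [x Kx x_max] := usc_on_compact_max cK (ex_intro _ z Kz) uscK.
rewrite /ballmax -KE; have [clx /= /andP[_ xr]] := Kx.
exists x; split=> //; last by move=> y cly yr; apply: x_max; rewrite KE.
apply/le_anti/andP; split.
  by apply: ub_le_sup; [exists (u x) => _ [y Ky <-]; exact: x_max|exists x].
by apply: ge_sup; [exists (u z), z|move=> _ [y Ky <-]; exact: x_max].
Qed.

Lemma le_ballmax r y : enorm z <= r -> closure Omega y -> enorm y <= r ->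
  u y <= ballmax r.
Proof. by move=> /ballmax_attained[x [_ _ <- x_max]]; exact: x_max. Qed.

Lemma ballmax_gt0 r : enorm z <= r -> 0 < ballmax r.
Proof. by move=> zr; exact: lt_le_trans uz (le_ballmax zr clz zr). Qed.

Lemma maximizer_nonempty r : enorm z <= r -> maximizer r !=set0.
Proof.
move=> zr; have [x [clx xr uxE x_max]] := ballmax_attained zr.
have ux0 : 0 < u x by rewrite uxE ballmax_gt0.
have Ox := solution_gt0_mem clx ux0.
exists x; split=> //; apply/eqP; rewrite eq_le xr /= leNgt; apply/negP => xr'.
move: ux0; rewrite ltNge => /negP; apply.
apply: (solution_local_max_le0 Ox (d := r - enorm x)).
  by rewrite subr_gt0.
move=> y Oy yx; apply: x_max; first exact: subset_closure.
by have := ler_dist_enorm y x; rewrite ler_norml => /andP[_ ?]; lra.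
Qed.

Lemma ballmax_lt r s : enorm z <= r -> r < s -> ballmax r < ballmax s.
Proof.
move=> zr rs; have zs := le_trans zr (ltW rs).
have [x [Ox xr ux]] := maximizer_nonempty zr.
have ux_le y : Omega y -> enorm y <= s -> u y <= ballmax s.
  by move=> Oy; exact: le_ballmax zs (subset_closure Oy).
rewrite -ux lt_neqAle ux_le ?xr ?(ltW rs)// andbT; apply/eqP => uxE.
have := ballmax_gt0 zr; rewrite -ux ltNge => /negP; apply.
apply: (solution_local_max_le0 Ox (d := s - r)); first by rewrite subr_gt0.
move=> y Oy yx; rewrite uxE; apply: ux_le => //.
by have := ler_dist_enorm y x; rewrite xr ler_norml => /andP[_ ?]; lra.
Qed.

Lemma f_maximizer_gt0 r x : enorm z <= r -> maximizer r x -> 0 < f x (u x).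
Proof. by move=> zr [Ox _ uxE]; rewrite f_gt0// uxE ballmax_gt0. Qed.

Lemma source_le r x : enorm z <= r -> maximizer r x -> source r <= f x (u x).
Proof.
move=> zr xmax; apply: ge_inf; last by exists x.
by exists 0 => _ [y ymax <-]; apply: ltW; exact: f_maximizer_gt0 zr ymax.
Qed.

Lemma le_source r c : enorm z <= r ->
  (forall x, maximizer r x -> c <= f x (u x)) -> c <= source r.
Proof.
move=> zr c_le; have [x xmax] := maximizer_nonempty zr.
by apply: lb_le_inf; [exists (f x (u x)), x|move=> _ [y ymax <-]; exact: c_le].
Qed.

Lemma source_ge0 r : enorm z <= r -> 0 <= source r.
Proof. by move=> zr; apply: le_source => // x /(f_maximizer_gt0 zr)/ltW. Qed.

Lemma ballmax_touching (phi : R -> R) (a b y : R) : continuous phi ->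
  enorm z <= a -> a <= y <= b -> phi y < ballmax y ->
  exists x, [/\ a <= enorm x <= b, maximizer (enorm x) x, phi (enorm x) < u x &
    forall v, closure Omega v -> a <= enorm v <= b ->
      u v - phi (enorm v) <= u x - phi (enorm x)].
Proof.
move=> cphi za yab phi_lt; have [ay _] := andP yab; have [_ [uscu _]] := u_sol.
have [w [Ow wE uw]] := maximizer_nonempty (le_trans za ay).
pose K := closure Omega `&` [set x | a <= enorm x <= b].
have Kw : K w by split; [exact: subset_closure|rewrite /= wE].
have uscK : usc_on K (u \- (phi \o @enorm R n)).
  apply: usc_onB; last by apply: usc_onS uscu => x [].
  by move=> x; apply: continuous_comp; [exact: enorm_continuous|exact: cphi].
have cK : compact K by exact: compact_annulus.
have [x [clx xab] x_max] := usc_on_compact_max cK (ex_intro _ w Kw) uscK.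
have phi_lt_u : phi (enorm x) < u x.
  have := x_max w Kw; rewrite /= wE uw => h.
  by rewrite -subr_gt0; apply: lt_le_trans h; rewrite subr_gt0.
have zx : enorm z <= enorm x by case/andP: xab => /(le_trans za).
have [x' [Ox' x'E ux']] := maximizer_nonempty zx.
have uxE : u x = ballmax (enorm x).
  apply/le_anti; rewrite le_ballmax//= -ux' -(lerD2r (- phi (enorm x))).
  have := x_max x'; rewrite /= x'E; apply.
  by split; [exact: subset_closure|rewrite /= x'E].
exists x; split=> //; last by move=> v clv vab; exact: x_max.
by split=> //; apply: solution_gt0_mem => //; rewrite uxE ballmax_gt0.
Qed.

Lemma ballmax_subsolution : comparison_with_parabolas ballmax source (enorm z).
Proof.
move=> a b lam za ab lam0 source_ge y yab; rewrite leNgt; apply/negP => Ny.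
set phi := chord_parabola ballmax lam a b in Ny.
have [x [xab xmax phi_lt x_touch]] :=
  ballmax_touching (@chord_parabola_continuous _ _ _ _ _) za yab Ny.
have [Ox _ uxE] := xmax; move: xab; rewrite !le_eqVlt => /andP[ax xb].
have {}ax : a < enorm x.
  case/predU1P: ax => // axE; move: phi_lt.
  by rewrite uxE -axE chord_parabola_left ltxx.
have {}xb : enorm x < b.
  case/predU1P: xb => // xbE; move: phi_lt.
  by rewrite uxE xbE chord_parabola_right// ltxx.
have zx := le_trans za (ltW ax).
pose beta := chord_slope ballmax a b + lam / 2 * (2 * enorm x - a - b).
have f_le : f x (u x) <= beta ^+ 2 * lam.
  pose d := Num.min (enorm x - a) (b - enorm x).
  apply: (solution_radial_touching (phi := phi) (d := d)) => //.
  - exact: le_lt_trans (enorm_ge0 z) (le_lt_trans za ax).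
  - by rewrite lt_min !subr_gt0 ax.
  - move=> v Ov; rewrite lt_min => /andP[va vb].
    have := ler_dist_enorm v x; rewrite ler_norml => /andP[? ?].
    have := x_touch v (subset_closure Ov); rewrite (_ : a <= enorm v <= b).
      by move=> /(_ isT); rewrite -/phi; lra.
    by apply/andP; split; lra.
  - by move=> s; exact: chord_parabola_expansion.
have := lt_le_trans (f_maximizer_gt0 zx xmax) f_le.
have [->|lam_neq0] := eqVneq lam 0; first by rewrite mulr0 ltxx.
have lam_gt0 : 0 < lam by rewrite lt_neqAle eq_sym lam_neq0.
have x_itv : a < enorm x < b by rewrite ax.
have := le_trans (source_ge _ x_itv) (le_trans (source_le zx xmax) f_le).
rewrite ler_pM2r// -/beta leNgt => /negP + _; apply.
have s0 : 0 <= chord_slope ballmax a b.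
  by rewrite divr_ge0 ?subr_ge0 ?(ltW ab)// ltW// ballmax_lt.
have : lam * a < lam * enorm x by rewrite ltr_pM2l.
have : lam * enorm x < lam * b by rewrite ltr_pM2l.
move=> xb' ax'; rewrite -real_normK ?num_real// ltr_sqr ?nnegrE//; last lra.
by rewrite ltr_norml /beta; apply/andP; split; lra.
Qed.

End MaximumOnBalls.

Section Clocks.
Context {R : realType}.
Implicit Types (N g T : R -> R) (theta kap m G lo hi y : R).

Definition near_minorant theta g m G :=
  exists t, [/\ 0 < t, t / theta < m < t * theta & G <= g t].

Lemma near_minorant_self theta g m G : 1 < theta -> 0 < m -> G <= g m ->
  near_minorant theta g m G.
Proof.
move=> theta1 m0 Gm; exists m; split=> //.
by rewrite ltr_pdivrMr ?(lt_trans _ theta1)// ltr_pMr// theta1.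
Qed.

(* The model is a primitive of min(1, r Q(r)) / r when N'^2 N'' >= Q(r) g(N/r). *)
Record clock N theta g kap (r0 : R) T : Prop := Clock {
  clock_continuous : continuous T ;
  clock_log_lipschitz : forall a b, r0 <= a -> a <= b ->
    T b - T a <= kap / a * (b - a) ;
  clock_cube_gain : forall a b G, r0 <= a -> a <= b -> 0 <= G ->
    (forall r, a <= r <= b -> near_minorant theta g (N r / r) G) ->
    G / 8 * (T b - T a) <= right_deriv N b ^+ 3 - right_deriv N a ^+ 3 }.

(* A clock spends a time O(y^4 + y) with N r / r in [lo, hi]: see [level_time]. *)
Definition crossing_scale theta g lo hi y := exists G, [/\ 0 < G, 0 < y, 0 < hi,
  forall m, lo <= m <= hi -> near_minorant theta g m G &
  hi ^+ 3 <= G * y ^+ 4].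

Lemma continuous_intermediate T a b v :
  continuous T -> a <= b -> T a <= v <= T b ->
  exists2 r, a <= r <= b & T r = v.
Proof.
move=> cT ab /andP[av vb]; have [|||r rab rE] := @IVT R T a b v => //.
- exact: continuous_subspaceT.
- by rewrite min_l ?max_r// ?av// (le_trans av).
by exists r => //; rewrite in_itv in rab.
Qed.

(* Eliminating D: (tau D)^3 <= (4 kap C)^3 and G tau <= 16 D^3 bound tau^4. *)
Lemma le_scale_of_slope_bounds kap C G y D tau : 0 <= C -> 0 < G -> 0 <= y ->
  1 <= kap -> 0 <= D -> 0 <= tau -> C ^+ 3 <= G * y ^+ 4 ->
  G * tau <= 16 * D ^+ 3 -> tau * D <= 4 * kap * C -> tau <= 8 * kap * y.
Proof.
move=> C0 G0 y0 kap1 D0 tau0 Cy tau_slope slope_C.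
have kap0 : 0 <= kap by exact: le_trans kap1.
have y4 : 0 <= y ^+ 4 by rewrite exprn_ge0.
have kap3 : 0 <= kap ^+ 3 by rewrite exprn_ge0.
have tauD3 : tau ^+ 3 * D ^+ 3 <= 64 * kap ^+ 3 * C ^+ 3.
  rewrite -exprMn (_ : 64 * _ * _ = (4 * kap * C) ^+ 3); last by ring.
  by rewrite lerXn2r ?nnegrE// !mulr_ge0.
have tau4 : G * tau ^+ 4 <= G * (1024 * kap ^+ 3 * y ^+ 4).
  have := ler_wpM2l (exprn_ge0 3 tau0) tau_slope.
  by have := ler_wpM2l kap3 Cy; rewrite (exprS tau 3); lra.
rewrite ler_pM2l// in tau4.
rewrite -(@ler_pXn2r _ 4) ?nnegrE ?mulr_ge0//; apply: le_trans tau4 _.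
have : kap ^+ 3 * y ^+ 4 <= kap ^+ 3 * y ^+ 4 * kap.
  by rewrite ler_peMr// mulr_ge0.
rewrite (_ : (8 * kap * y) ^+ 4 = 4096 * (kap ^+ 3 * y ^+ 4 * kap)); last first.
  by ring.
by have := mulr_ge0 kap3 y4; lra.
Qed.

End Clocks.

Section RatioGrowth.
Context {R : realType} (N g : R -> R) (ra r0 theta kap : R).
Implicit Types (r a b c C G y : R) (T : R -> R).
Hypothesis N_lt : forall r s, ra <= r -> r < s -> N r < N s.
Hypothesis N_convex : forall a b y, ra <= a -> a < b -> a <= y <= b ->
  N y <= N a + chord_slope N a b * (y - a).
Hypothesis N_gt0 : forall r, ra <= r -> 0 < N r.
Hypotheses (ra_ge0 : 0 <= ra) (ra_r0 : ra < r0).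
Hypotheses (theta1 : 1 < theta) (kap1 : 1 < kap).
Notation clock := (clock N theta g kap r0).
Notation crossing_scale := (crossing_scale theta g).

Let D_gt0 := right_deriv_gt0 N_lt N_convex.
Let r_gt0 r : r0 <= r -> 0 < r.
Proof. by move=> r0r; exact: lt_le_trans (le_lt_trans ra_ge0 ra_r0) r0r. Qed.

Lemma exit_time r b C : ra <= r -> r <= b -> 0 <= C -> N b <= C * b ->
  2 * C <= right_deriv N r -> right_deriv N r * (b - r) <= 2 * C * r.
Proof.
move=> rar rb C0 NbC DC; have Nr := N_gt0 rar.
have := supporting_line N_lt rar rb.
have : 2 * C * (b - r) <= right_deriv N r * (b - r).
  by rewrite ler_wpM2r// subr_ge0.
lra.
Qed.

Lemma midtime_slope T a b G : clock T -> 0 <= G -> r0 <= a -> a <= b ->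
  T a <= T b -> (forall r, a <= r <= b -> near_minorant theta g (N r / r) G) ->
  exists r, [/\ a <= r <= b, T b - T r = (T b - T a) / 2 &
    G * (T b - T a) <= 16 * right_deriv N r ^+ 3].
Proof.
move=> [cT _ T_gain] G0 r0a ab Tab G_minorant.
have [|r /andP[ar rb] TrE] :=
  continuous_intermediate (v := (T a + T b) / 2) cT ab.
  by apply/andP; split; lra.
exists r; split; [by rewrite ar|by rewrite TrE; field|].
have : G / 8 * (T r - T a) <= right_deriv N r ^+ 3 - right_deriv N a ^+ 3.
  apply: T_gain => // s /andP[a_s sr].
  by apply: G_minorant; rewrite a_s (le_trans sr).
have : 0 < right_deriv N a ^+ 3.
  by rewrite exprn_gt0// D_gt0// (lt_le_trans ra_r0).
rewrite TrE (_ : G / 8 * _ = G * (T b - T a) / 16); first lra.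
by field.
Qed.

(* Half of the time spent in a level raises the slope; with that slope, the
   supporting line forces N r / r out of the level during the other half. *)
Lemma level_time T a b lo hi y : clock T -> crossing_scale lo hi y ->
  r0 <= a -> a <= b -> (forall r, a <= r <= b -> lo <= N r / r <= hi) ->
  T b - T a <= 128 * y ^+ 4 + 8 * kap * y.
Proof.
move=> clockT [G [G0 y0 hi0 G_minorant hi_le]] r0a ab in_level.
have kap0 : 0 < kap by exact: lt_trans kap1.
have y4 : 0 < y ^+ 4 by rewrite exprn_gt0.
have ky : 0 < kap * y by rewrite mulr_gt0.
set tau := T b - T a; have [tau_le0|tau0] := leP tau 0; first lra.
have Tab : T a <= T b by rewrite -subr_ge0 ltW.
have [r [/andP[ar rb] TbrE D3]] := midtime_slope clockT (ltW G0) r0a ab Tab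
  (fun s sab => G_minorant _ (in_level s sab)).
rewrite -/tau in TbrE D3.
have r0r := le_trans r0a ar; have rar := lt_le_trans ra_r0 r0r.
have := D_gt0 rar; set D := right_deriv N r in D3 * => D0.
have [slow|fast] := ltP D (2 * hi).
  have : D ^+ 3 <= (2 * hi) ^+ 3.
    by rewrite lerXn2r ?nnegrE ?(ltW D0) ?(ltW slow)// mulr_ge0// ltW.
  rewrite (_ : (2 * hi) ^+ 3 = 8 * hi ^+ 3); last by ring.
  move=> slow3; have : G * tau <= G * (128 * y ^+ 4) by lra.
  by rewrite ler_pM2l//; lra.
have Nb : N b <= hi * b.
  rewrite -ler_pdivrMr ?(r_gt0 (le_trans r0a ab))//.
  by have /andP[] := in_level b (introT andP (conj ab (lexx b))).
apply: (@le_trans _ _ (8 * kap * y)); last lra.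
apply: (le_scale_of_slope_bounds (ltW hi0) G0 (ltW y0) (ltW kap1) (ltW D0)
  (ltW tau0) hi_le D3).
have kr0 : 0 <= kap / r by rewrite divr_ge0 ?(ltW kap0) ?(ltW (r_gt0 r0r)).
have : tau / 2 * D <= kap / r * (b - r) * D.
  by rewrite ler_wpM2r ?(ltW D0)// -TbrE; exact: (clock_log_lipschitz clockT).
have := ler_wpM2l kr0 (exit_time (ltW rar) rb (ltW hi0) Nb fast).
rewrite -/D (_ : kap / r * (2 * hi * r) = 2 * kap * hi); first lra.
by field; rewrite gt_eqF ?r_gt0.
Qed.

Lemma time_below_level T r b (lv y : nat -> R) j : clock T -> r0 <= r ->
  (forall s t, r <= s -> s <= t -> N s / s <= N t / t) -> lv 0%N <= N r / r ->
  (forall i, crossing_scale (lv i) (lv i.+1) (y i)) ->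
  r <= b -> N b / b < lv j ->
  T b - T r <= \sum_(i < j) (128 * y i ^+ 4 + 8 * kap * y i).
Proof.
move=> clockT r0r ratio_le lv0 scale; elim: j b => [|j IH] b rb ratio_lt.
  by have := le_lt_trans (ratio_le _ _ (lexx r) rb) ratio_lt; rewrite ltNge lv0.
have cost_ge0 i : 0 <= 128 * y i ^+ 4 + 8 * kap * y i.
  have [G [_ /ltW yi _ _ _]] := scale i; have kap0 := ltW (lt_trans ltr01 kap1).
  by rewrite addr_ge0// !mulr_ge0// exprn_ge0.
rewrite leNgt; apply/negP; rewrite big_ord_recr /=.
set S := \sum_(i < j) _ in IH *; set L := _ + 8 * kap * y j => late.
have S0 : 0 <= S by apply: sumr_ge0.
have L0 : 0 <= L by exact: cost_ge0.
have [|a /andP[r_a ab] TaE] := continuous_intermediate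
  (v := T r + (S + (T b - T r - L)) / 2) (clock_continuous clockT) rb.
  by apply/andP; split; lra.
have level_a : lv j <= N a / a.
  by rewrite leNgt; apply/negP => /(IH a r_a); rewrite TaE; lra.
have : T b - T a <= L; last by rewrite TaE; lra.
apply: (level_time clockT (scale j)) => //; first exact: le_trans r0r r_a.
move=> s /andP[a_s sb]; apply/andP; split.
  exact: le_trans level_a (ratio_le _ _ r_a a_s).
exact: le_trans (ratio_le _ _ (le_trans r_a a_s) sb) (ltW ratio_lt).
Qed.

Lemma total_time_bounded r (lv y : nat -> R) : r0 <= r ->
  (forall s t, r <= s -> s <= t -> N s / s <= N t / t) -> lv 0%N <= N r / r ->
  (forall x, exists j, x < lv j) ->
  (forall i, crossing_scale (lv i) (lv i.+1) (y i)) -> cvgn (series y) ->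
  exists B, forall T b, clock T -> r <= b -> T b - T r <= B.
Proof.
move=> r0r ratio_le lv0 lv_unbounded scale y_cvg.
have y_gt0 i : 0 < y i by have [G []] := scale i.
set Y := limn (series y).
have sum_y J : \sum_(i < J) y i <= Y.
  rewrite -(big_mkord xpredT y); apply: nondecreasing_cvgn_le => //.
  by apply/nondecreasing_seqP => i; rewrite seriesSr lerDl ltW.
have y_le i : y i <= Y.
  apply: le_trans (sum_y i.+1); rewrite big_ord_recr /= lerDr.
  by apply: sumr_ge0 => k _; exact: ltW.
have Y0 : 0 <= Y by exact: le_trans (ltW (y_gt0 0%N)) (y_le 0%N).
have kap0 : 0 < kap by exact: lt_trans kap1.
exists ((128 * Y ^+ 3 + 8 * kap) * Y) => T b clockT rb.
have [j ratio_lt] := lv_unbounded (N b / b).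
apply: le_trans (time_below_level clockT r0r ratio_le lv0 scale rb ratio_lt) _.
pose K := 128 * Y ^+ 3 + 8 * kap.
apply: (@le_trans _ _ (K * \sum_(i < j) y i)); last first.
  by rewrite ler_wpM2l// addr_ge0// mulr_ge0// ?exprn_ge0// ltW.
rewrite mulr_sumr; apply: ler_sum => i _.
have yi := ltW (y_gt0 i).
rewrite [leRHS]mulrDl lerD2r exprSr mulrA ler_wpM2r// ler_wpM2l//.
by rewrite lerXn2r ?nnegrE.
Qed.

Hypothesis g_minorant : forall c C, 0 < c ->
  exists2 gam, 0 < gam & forall m, c <= m <= C -> gam <= g m.
Hypothesis clocks_diverge : forall B,
  exists T b, [/\ clock T, r0 <= b & B < T b - T r0].

Lemma ratio_unbounded C : exists2 r, r0 <= r & C < N r / r.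
Proof.
apply: contrapT => bounded.
have ratio_le r : r0 <= r -> N r / r <= C.
  by move=> r0r; rewrite leNgt; apply/negP => Cr; apply: bounded; exists r.
have C0 : 0 <= C.
  apply: le_trans (ratio_le r0 (lexx _)).
  by rewrite divr_ge0// ltW ?N_gt0 ?r_gt0// ltW.
have [c c0 c_le] :=
  ratio_lower_bound N_lt N_convex ra_ge0 ra_r0 (N_gt0 (ltW ra_r0)).
have [gam gam0 gam_le] := g_minorant C c0.
have [T [b [clockT r0b T_large]]] := clocks_diverge ((2 * C) ^+ 3 / (gam / 8)).
have rab := lt_le_trans ra_r0 r0b.
have gain : gam / 8 * (T b - T r0) <=
    right_deriv N b ^+ 3 - right_deriv N r0 ^+ 3.
  apply: (clock_cube_gain clockT) => [//|//||r /andP[r0r _]]; first exact: ltW.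
  apply: near_minorant_self => //; first exact: lt_le_trans (c_le r r0r).
  by apply: gam_le; rewrite c_le// ratio_le.
have Db : right_deriv N b <= 2 * C.
  apply: (right_deriv_le_ratio N_lt ra_ge0) => //; first exact/ltW/N_gt0/ltW.
  have b0 := r_gt0 r0b; rewrite -ler_pdivrMr ?mulr_gt0// ratio_le//; lra.
have Db3 : right_deriv N b ^+ 3 <= (2 * C) ^+ 3.
  by rewrite lerXn2r ?nnegrE ?mulr_ge0 ?(ltW (D_gt0 rab)).
have D0 : 0 < right_deriv N r0 ^+ 3 by rewrite exprn_gt0// D_gt0.
by move: T_large; rewrite ltr_pdivrMr ?divr_gt0//; lra.
Qed.

Lemma ratio_increasing_start :
  exists r, [/\ r0 <= r, 1 <= N r / r & N r / r <= right_deriv N r].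
Proof.
have [r r0r] := ratio_unbounded (Num.max 1 (N r0 / r0)).
rewrite gt_max => /andP[ratio1 ratio0]; exists r; split=> //; first exact: ltW.
apply: (ratio_le_right_deriv N_convex ra_ge0 ra_r0) => //.
by rewrite lt_neqAle r0r andbT; apply: contraTneq ratio0 => <-; rewrite ltxx.
Qed.

Lemma no_global_growth : (forall c, 1 <= c -> exists lv y : nat -> R,
    [/\ lv 0%N <= c, forall x, exists j, x < lv j,
      forall i, crossing_scale (lv i) (lv i.+1) (y i) & cvgn (series y)]) ->
  False.
Proof.
move=> levels; have [r [r0r ratio1 ratioD]] := ratio_increasing_start.
have [lv [y [lv0 lv_unbounded scale y_cvg]]] := levels _ ratio1.
have ratio_le s t : r <= s -> s <= t -> N s / s <= N t / t.
  exact: (ratio_nondecreasing N_lt N_convex ra_ge0 (lt_le_trans ra_r0 r0r)).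
have [B time_le] :=
  total_time_bounded r0r ratio_le lv0 lv_unbounded scale y_cvg.
have [T [b [clockT r0b]]] := clocks_diverge (Num.max 0 B + kap / r0 * (r - r0)).
have k0 : 0 <= kap / r0.
  by rewrite divr_ge0 ?(ltW (r_gt0 (lexx r0)))// ltW// (lt_trans _ kap1).
have T_lip := clock_log_lipschitz clockT (lexx r0).
apply/negP; rewrite -leNgt; have [rb|/ltW br] := leP r b.
  have : B <= Num.max 0 B by rewrite le_max lexx orbT.
  by have := time_le T b clockT rb; have := T_lip r r0r; lra.
apply: le_trans (T_lip b r0b) _.
have : 0 <= Num.max 0 B by rewrite le_max lexx.
have : kap / r0 * (b - r0) <= kap / r0 * (r - r0) by rewrite ler_wpM2l// lerD2r.
lra.
Qed.

End RatioGrowth.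

Section StepPrimitives.
Context {R : realType}.
Implicit Types (lo hi a b p q r x y : R) (w c : nat -> R).

Definition clamp lo hi r := Num.min (Num.max r lo) hi.

Lemma clamp_exchange a b p q : a <= b -> p <= q ->
  clamp p q b - clamp p q a = clamp a b q - clamp a b p.
Proof.
rewrite /clamp => ab pq.
case: (leP p a) => pa; case: (leP p b) => pb; try lra;
case: (leP q a) => qa; case: (leP q b) => qb; try lra;
rewrite ?(min_l pq) ?(min_l ab) ?(min_r ab); try lra.
Qed.

Lemma clamp_le lo hi p q : p <= q -> clamp lo hi p <= clamp lo hi q.
Proof.
by move=> pq; rewrite le_min ge_min ge_max !le_max !ge_min pq !lexx !orbT.
Qed.

Lemma clamp_lt lo hi p q : lo <= hi -> clamp lo hi p < clamp lo hi q ->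
  p <= clamp lo hi p /\ clamp lo hi q <= q.
Proof.
rewrite /clamp => lohi; case: (leP p lo) => pl; case: (leP q lo) => ql;
  rewrite ?(min_l lohi); try lra;
  case: (leP q hi) => ?; try lra; case: (leP p hi) => ?; lra.
Qed.

Lemma clamp_itv lo hi r : lo <= hi -> lo <= clamp lo hi r <= hi.
Proof.
by move=> lohi; rewrite le_min le_max lexx orbT lohi ge_min lexx orbT.
Qed.

(* Up to a constant, the primitive of the step function equal to [w k] on
   [c k, c k.+1] for [k < n] and to 0 elsewhere. *)
Definition step_primitive w c n r := \sum_(k < n) w k * clamp (c k) (c k.+1) r.

Lemma step_primitive_continuous w c n : continuous (step_primitive w c n).
Proof.
elim: n => [|n IH].
  rewrite (_ : step_primitive w c 0 = fun=> 0); first exact: cst_continuous.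
  by apply/funext => r; rewrite /step_primitive big_ord0.
have -> : step_primitive w c n.+1 =
    fun r => step_primitive w c n r + w n * clamp (c n) (c n.+1) r.
  by apply/funext => r; rewrite /step_primitive big_ord_recr.
move=> x; apply: cvgD; first exact: IH.
apply: cvgMr.
apply: (@continuous_min _ _ (fun r => Num.max r (c n)) (fun=> c n.+1)).
  apply: (@continuous_max _ _ id (fun=> c n)); first exact: cvg_id.
  exact: cvg_cst.
exact: cvg_cst.
Qed.

Lemma step_primitive_nondecreasing w c n x y : (forall k, 0 <= w k) -> x <= y ->
  step_primitive w c n x <= step_primitive w c n y.
Proof.
by move=> w0 xy; apply: ler_sum => k _; rewrite ler_wpM2l// clamp_le.
Qed.

Lemma step_primitive_total w c n : (forall k, c k <= c k.+1) ->
  step_primitive w c n (c n) - step_primitive w c n (c 0%N) =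
  \sum_(k < n) w k * (c k.+1 - c k).
Proof.
move=> /nondecreasing_seqP c_le.
rewrite -sumrB; apply: eq_bigr => k _; rewrite -mulrBr /clamp.
have ckn := c_le k.+1 n (ltn_ord k); have ck := c_le k k.+1 (leqnSn k).
have c0k := c_le 0%N k (leq0n k).
by rewrite (max_l (le_trans ck ckn)) (min_r ckn) (max_r c0k) (min_l ck).
Qed.

Lemma step_primitive_increment_le w c n (Phi : R -> R) K a b :
  (forall k, c k <= c k.+1) -> c 0%N <= a -> a <= b ->
  (forall x y, a <= x -> x <= y -> y <= b -> Phi x <= Phi y) ->
  (forall k x y, a <= x -> x < y -> y <= b -> c k <= x -> y <= c k.+1 ->
     K * (w k * (y - x)) <= Phi y - Phi x) ->
  K * (step_primitive w c n b - step_primitive w c n a) <= Phi b - Phi a.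
Proof.
move=> c_le c0a ab Phi_le window_le; pose e k := clamp a b (c k).
have e_itv k : a <= e k <= b by exact: clamp_itv.
apply: (@le_trans _ _ (Phi (e n) - Phi a)); last first.
  by rewrite lerD2r; have /andP[? ?] := e_itv n; exact: Phi_le.
elim: n => [|n IH].
  rewrite /step_primitive !big_ord0 subrr mulr0 (_ : e 0%N = a) ?subrr//.
  by rewrite /e /clamp max_r// min_l.
rewrite /step_primitive !big_ord_recr /= -!/(step_primitive w c n _).
have [an _] := andP (e_itv n); have [_ nb] := andP (e_itv n.+1).
have window_n : K * (w n * (e n.+1 - e n)) <= Phi (e n.+1) - Phi (e n).
  have : e n <= e n.+1 by exact: clamp_le.
  rewrite le_eqVlt => /predU1P[->|ee]; first by rewrite !subrr !mulr0.
  by have [? ?] := clamp_lt ab ee; exact: window_le.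
rewrite /e -(clamp_exchange ab (c_le n)) -!/(e _) in window_n.
by move: IH window_n; lra.
Qed.

End StepPrimitives.

Section GeometricGrowth.
Context {R : realType} (a z : R).
Hypotheses (a_gt0 : 0 < a) (z_gt1 : 1 < z).

Lemma geometric0 : geometric a z 0 = a.
Proof. by rewrite /geometric /= expr0 mulr1. Qed.

Lemma geometricS k : geometric a z k.+1 = z * geometric a z k.
Proof. by rewrite /geometric /= exprS mulrCA. Qed.

Lemma geometric_gt0 k : 0 < geometric a z k.
Proof. by rewrite mulr_gt0// exprn_gt0// (lt_trans _ z_gt1). Qed.

Lemma geometric_lt k : geometric a z k < geometric a z k.+1.
Proof. by rewrite geometricS ltr_pMl// geometric_gt0. Qed.

Lemma geometric_ge k : a <= geometric a z k.
Proof. by rewrite ler_peMr ?exprn_ege1// ltW. Qed.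

Lemma geometric_unbounded x : exists k, x < geometric a z k.
Proof.
have z_gt0 : 0 < z by exact: lt_trans z_gt1.
have x1 : 0 < `|x| + 1 by rewrite ltr_wpDl.
have /(@cvg_expr R) zV_cvg : `|z^-1| < 1.
  by rewrite ger0_norm ?invr_ge0 ?(ltW z_gt0)// invf_lt1.
have /cvgrPdist_lt/(_ _ (divr_gt0 a_gt0 x1))[k _ k_small] := zV_cvg.
exists k; have := k_small k (leqnn k); rewrite /= sub0r normrN.
rewrite exprVn ger0_norm ?invr_ge0 ?exprn_ge0 ?(ltW z_gt0)//.
rewrite ltr_pdivlMr// mulrC ltr_pdivrMr ?exprn_gt0//; apply: le_lt_trans.
by have := ler_norm x; lra.
Qed.

End GeometricGrowth.

Section WindowClocks.
Context {R : realType} (rs kap : R).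
Implicit Types (k n : nat).
Hypotheses (rs_gt0 : 0 < rs) (kap1 : 1 < kap).

Notation radius := (geometric rs kap).

Context (w : nat -> R) (N F g : R -> R) (ra r0 theta : R).
Hypotheses (w_ge0 : forall k, 0 <= w k) (w_le : forall k, w k * radius k <= 1).
Hypotheses (rs_r0 : rs <= r0) (ra_r0 : ra < r0).
Hypothesis N_lt : forall r s, ra <= r -> r < s -> N r < N s.
Hypothesis F_ge0 : forall r, ra <= r -> 0 <= F r.
Hypothesis N_sub : comparison_with_parabolas N F ra.
Hypothesis F_ge : forall k r t, ra <= r -> radius k <= r <= radius k.+1 ->
  0 < t -> t / theta < N r / r < t * theta -> w k * g t <= F r.

Let T := step_primitive w radius.
Let N_convex := subsolution_convex F_ge0 N_sub.
Let kap_ge0 : 0 <= kap := ltW (lt_trans ltr01 kap1).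
Let radius_le k : radius k <= radius k.+1 := ltW (geometric_lt rs_gt0 kap1 k).

Lemma window_log_lipschitz n a b : rs <= a -> a <= b ->
  T n b - T n a <= kap / a * (b - a).
Proof.
move=> rsa ab; have a0 := lt_le_trans rs_gt0 rsa.
have ka : 0 <= kap / a by rewrite divr_ge0 ?kap_ge0// ltW.
have := @step_primitive_increment_le _ w _ n ( *%R (kap / a)) 1 a b radius_le.
rewrite mul1r -mulrBr; apply=> //; first by rewrite geometric0.
  by move=> x y _ xy _; rewrite ler_wpM2l.
move=> k x y ax xy yb kx yk.
rewrite mul1r -mulrBr ler_wpM2r ?subr_ge0 ?(ltW xy)// ler_pdivlMr//.
apply: (@le_trans _ _ (w k * radius k.+1)).
  by rewrite ler_wpM2l//; lra.
by rewrite geometricS mulrCA ler_piMr ?kap_ge0.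
Qed.

Lemma window_clock n : clock N theta g kap r0 (T n).
Proof.
split=> [|a b r0a|a b G r0a ab G0 G_minorant].
- exact: step_primitive_continuous.
- exact/window_log_lipschitz/(le_trans rs_r0).
have raa := lt_le_trans ra_r0 r0a.
pose Phi r := right_deriv N r ^+ 3.
apply: (@step_primitive_increment_le _ w _ n Phi _ _ _ radius_le) => //.
- by rewrite geometric0 (le_trans rs_r0).
- move=> x y ax xy _; have rax := lt_le_trans raa ax.
  exact: (cube_right_deriv_le N_lt N_convex rax xy).
move=> k x y ax xy yb kx yk; have rax := lt_le_trans raa ax.
rewrite (_ : _ * _ = w k * G * (y - x) / 8); last by field.
apply: (cube_right_deriv_gain N_lt F_ge0 N_sub) => //; first exact: mulr_ge0.
move=> r /andP[/ltW xr /ltW ry].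
have [|t [t0 t_near Gt]] := G_minorant r.
  by rewrite (le_trans ax xr) (le_trans ry yb).
have r_window : radius k <= r <= radius k.+1.
  by rewrite (le_trans kx xr) (le_trans ry yk).
apply: le_trans (F_ge (ltW (lt_le_trans rax xr)) r_window t0 t_near).
by rewrite ler_wpM2l.
Qed.

Lemma window_clocks_diverge : ~ cvgn (series (fun k => w k * radius k)) ->
  forall B, exists T b, [/\ clock N theta g kap r0 T, r0 <= b & B < T b - T r0].
Proof.
move=> w_diverges B; apply: contrapT => bounded; apply: w_diverges.
have wr_ge0 k : 0 <= w k * radius k by rewrite mulr_ge0// ltW// geometric_gt0.
have kap10 : 0 < kap - 1 by rewrite subr_gt0.
apply: nondecreasing_is_cvgn.
  by apply/nondecreasing_seqP => k; rewrite seriesSr lerDl.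
exists ((B + kap / rs * (r0 - rs)) / (kap - 1)) => _ [n _ <-].
rewrite ler_pdivlMr// seriesEord /= mulr_suml.
have -> : \sum_(k < n) w k * radius k * (kap - 1) = T n (radius n) - T n rs.
  rewrite -[in T n rs](geometric0 rs kap) (step_primitive_total _ _ radius_le).
  by apply: eq_bigr => k _; rewrite geometricS; ring.
pose b := Num.max r0 (radius n).
have r0b : r0 <= b by rewrite le_max lexx.
have Tb : T n b - T n r0 <= B.
  rewrite leNgt; apply/negP => Bb; apply: bounded.
  by exists (T n), b; split=> //; exact: window_clock.
have : T n (radius n) <= T n b.
  by apply: step_primitive_nondecreasing; rewrite ?le_max ?lexx ?orbT.
by have := window_log_lipschitz n (lexx rs) rs_r0; lra.
Qed.

End WindowClocks.

Section MeanValue.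
Context d (T : measurableType d) {R : realType}.
Variable mu : {measure set T -> \bar R}.
Implicit Types (D : set T) (h : T -> R).

Lemma integral_gt0_eq0 D h : measurable D -> measurable_fun D h ->
  (forall x, D x -> 0 < h x) -> (\int[mu]_(x in D) (h x)%:E = 0)%E -> mu D = 0.
Proof.
move=> mD mh h0 int0.
have mhE : measurable_fun D (EFin \o h) by exact/measurable_EFinP.
have : (\int[mu]_(x in D) `|(h x)%:E| = 0)%E.
  rewrite -[RHS]int0; apply: eq_integral => x /set_mem Dx.
  by rewrite gee0_abs// lee_fin ltW// h0.
rewrite (ae_eq_integral_abs mu mD mhE) => -[Z [mZ Z0 DZ]].
apply/eqP; rewrite eq_le measure_ge0 andbT -Z0.
apply: le_measure; rewrite ?inE// => x Dx; apply: DZ => /(_ Dx)[] hx0.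
by have := h0 x Dx; rewrite hx0 ltxx.
Qed.

Lemma exists_le_average D h : measurable D -> (0 < mu D < +oo)%E ->
  measurable_fun D h -> (forall x, D x -> 0 <= h x) ->
  exists2 x, D x & ((h x)%:E * mu D <= \int[mu]_(x in D) (h x)%:E)%E.
Proof.
move=> mD /andP[mu0 mu_fin] mh h0; apply: contrapT => above.
set I := (\int[mu]_(x in D) (h x)%:E)%E in above.
have I_lt x : D x -> (I < (h x)%:E * mu D)%E.
  by move=> Dx; rewrite ltNge; apply/negP => hx; apply: above; exists x.
have mE : mu D = (fine (mu D))%:E by rewrite fineK// ge0_fin_numE// ltW.
have m0 : 0 < fine (mu D) by rewrite fine_gt0// mu0.
have [x0 Dx0] : D !=set0.
  by apply/set0P/eqP => D0; move: mu0; rewrite D0 measure0 ltxx.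
have I0 : (0 <= I)%E by apply: integral_ge0 => x Dx; rewrite lee_fin h0.
have IE : I = (fine I)%:E.
  rewrite fineK// ge0_fin_numE//; apply: lt_trans (I_lt x0 Dx0) _.
  by rewrite mE -EFinM ltry.
pose M := fine I / fine (mu D).
have M0 : 0 <= M by rewrite divr_ge0 ?fine_ge0// ltW.
have hM x : D x -> 0 < h x - M.
  by move=> Dx; rewrite subr_gt0 ltr_pdivrMr// -lte_fin EFinM -mE -IE I_lt.
have mhM : measurable_fun D (fun x => h x - M) by exact: measurable_funB.
have I_split : (I = \int[mu]_(x in D) (h x - M)%:E + I)%E.
  have ME : (\int[mu]_(x in D) M%:E = I)%E.
    by rewrite integral_cst// mE -EFinM /M divfK ?gt_eqF// -IE.
  rewrite -[X in (_ + X)%E]ME -ge0_integralD//.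
  - by rewrite /I; apply: eq_integral => x _; rewrite -EFinD subrK.
  - by move=> x Dx; rewrite lee_fin ltW// hM.
  - exact/measurable_EFinP.
have int0 : (\int[mu]_(x in D) (h x - M)%:E = 0)%E.
  move: I_split; rewrite IE.
  by case: (\int[mu]_(x in D) _)%E => [r| |]//= -[rE]; congr EFin; lra.
by move: mu0; rewrite (integral_gt0_eq0 mD mhM hM int0) ltxx.
Qed.

End MeanValue.

Section WindowIntegrals.
Context {R : realType}.
Implicit Types (a b : R) (c : R^nat) (h : R -> R).
Notation mu := (@completed_lebesgue_measure R).

Lemma borel_LebR (A : set R) : measurable A -> measurable (A : set (LebR R)).
Proof. by move=> mA; apply: sub_caratheodory; exact: mA. Qed.

Lemma measurable_itv_LebR (i : interval R) :
  measurable ([set` i] : set (LebR R)).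
Proof. by apply: borel_LebR; exact: measurable_itv. Qed.

Lemma measurable_id_LebR (D : set R) :
  measurable_fun (D : set (LebR R)) (id : LebR R -> R).
Proof.
move=> mD B mB; apply: measurableI => //.
by rewrite (_ : _ @^-1` B = B)//; exact: borel_LebR.
Qed.

Lemma completed_lebesgue_measure_itv_oc a b : a <= b ->
  mu `]a, b]%classic = (b - a)%:E.
Proof.
move=> ab; transitivity (lebesgue_measure (`]a, b]%classic : set R)) => //.
rewrite lebesgue_measure_itv /= lte_fin; case: ltP => // ba.
by rewrite (_ : b = a) ?subrr//; apply/le_anti/andP.
Qed.

Lemma trivIset_itv_oc c : {homo c : k l / (k <= l)%N >-> k <= l} ->
  trivIset setT (fun k => `]c k, c k.+1]%classic).
Proof.
move=> c_le; apply: ltn_trivIset => l k kl; apply/seteqP; split=> // x [].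
rewrite /= !in_itv /= => /andP[_ xk] /andP[lx _].
by have := le_lt_trans (le_trans xk (c_le _ _ kl)) lx; rewrite ltxx.
Qed.

Lemma bigcup_itv_oc c : {homo c : k l / (k <= l)%N >-> k <= l} ->
  (forall x, exists k, x < c k) ->
  \bigcup_k `]c k, c k.+1]%classic = `]c 0%N, +oo[%classic.
Proof.
move=> c_le c_unbounded; apply/seteqP; split=> x /=.
  case=> k _; rewrite /= !in_itv /= andbT => /andP[kx _].
  exact: le_lt_trans (c_le 0%N k _) kx.
rewrite in_itv /= andbT => c0x.
have x_le : exists k, x <= c k by have [k /ltW] := c_unbounded x; exists k.
case: (ex_minnP x_le) => -[|k] xk k_min; first by rewrite leNgt c0x in xk.
exists k => //; rewrite /= in_itv /= xk andbT ltNge; apply/negP => /k_min.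
by rewrite ltnn.
Qed.

Lemma integral_windows c h : {homo c : k l / (k <= l)%N >-> k <= l} ->
  (forall x, exists k, x < c k) ->
  measurable_fun (`]c 0%N, +oo[ : set (LebR R)) (h : LebR R -> R) ->
  (forall x, c 0%N < x -> 0 <= h x) ->
  (\int[mu]_(x in `]c 0%N, +oo[) (h x)%:E =
   \sum_(0 <= k <oo) \int[mu]_(x in `]c k, c k.+1]) (h x)%:E)%E.
Proof.
move=> c_le c_unbounded mh h0; rewrite -(bigcup_itv_oc c_le c_unbounded).
apply: ge0_integral_bigcup.
- by move=> k; exact: measurable_itv_LebR.
- by rewrite bigcup_itv_oc//; exact/measurable_EFinP.
- move=> x; rewrite bigcup_itv_oc//= in_itv /= andbT => c0x.
  by rewrite lee_fin h0.
- exact: trivIset_itv_oc.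
Qed.

Lemma integral_itv_oc_le h a b M : a <= b ->
  measurable_fun (`]a, b]%classic : set (LebR R)) (h : LebR R -> R) ->
  (forall x, a < x <= b -> 0 <= h x <= M) ->
  (\int[mu]_(x in `]a, b]) (h x)%:E <= (M * (b - a))%:E)%E.
Proof.
move=> ab mh hM.
rewrite EFinM -(completed_lebesgue_measure_itv_oc ab).
rewrite -(integral_cst mu (measurable_itv_LebR `]a, b])).
apply: ge0_le_integral.
- exact: measurable_itv_LebR.
- by move=> x /=; rewrite in_itv => /hM /andP[h0 _]; rewrite lee_fin.
- exact/measurable_EFinP.
- exact: measurable_cst.
- by move=> x /=; rewrite in_itv => /hM /andP[_ ?]; rewrite lee_fin.
Qed.

Lemma exists_le_average_itv_oc h a b : a < b ->
  measurable_fun (`]a, b]%classic : set (LebR R)) (h : LebR R -> R) ->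
  (forall x, a < x <= b -> 0 <= h x) ->
  exists2 x, a < x <= b &
    ((h x * (b - a))%:E <= \int[mu]_(x in `]a, b]) (h x)%:E)%E.
Proof.
move=> ab mh h0; have lenE := completed_lebesgue_measure_itv_oc (ltW ab).
have len_itv : (0 < mu `]a, b]%classic < +oo)%E.
  by rewrite lenE lte_fin subr_gt0 ab ltry.
have [x x_in hx] : exists2 x, `]a, b]%classic x &
    ((h x)%:E * mu `]a, b]%classic <= \int[mu]_(x in `]a, b]) (h x)%:E)%E.
  apply: (@exists_le_average _ (LebR R) R mu `]a, b]%classic h) => //.
  exact: measurable_itv_LebR.
by exists x; [rewrite /= in_itv in x_in|rewrite EFinM -lenE].
Qed.

End WindowIntegrals.

Section WindowSelection.
Context {R : realType}.
Notation mu := (@completed_lebesgue_measure R).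

Lemma exists_half_sup (T : Type) (S : set T) (q : T -> R) M : S !=set0 ->
  (forall x, S x -> 0 <= q x <= M) ->
  exists2 r, S r & forall s, S s -> q s <= 2 * q r.
Proof.
move=> [x0 Sx0] q_itv; have ubM : ubound [set q x | x in S] M.
  by move=> _ [x Sx <-]; have /andP[] := q_itv x Sx.
have hsup : has_sup [set q x | x in S].
  by split; [exists (q x0), x0|exists M].
have le_sup x : S x -> q x <= sup [set q x | x in S].
  by move=> Sx; apply: ub_le_sup; [exists M|exists x].
have [sup_le0|sup_gt0] := leP (sup [set q x | x in S]) 0.
  exists x0 => // s Ss; apply: le_trans (le_trans (le_sup s Ss) sup_le0) _.
  by rewrite mulr_ge0//; have /andP[] := q_itv x0 Sx0.
have [_ [r Sr <-] sup_lt] := sup_adherent (divr_gt0 sup_gt0 (ltr0n _ 2)) hsup.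
by exists r => // s /le_sup; lra.
Qed.

Lemma is_cvg_series_min1 (a : R^nat) : (forall k, 0 <= a k) ->
  cvgn (series (fun k => Num.min 1 (a k))) -> cvgn (series a).
Proof.
move=> a0 min_cvg.
have /cvgrPdist_lt/(_ 1 ltr01)[K _ min_lt1] := cvg_series_cvg_0 min_cvg.
rewrite -(is_cvg_series_restrict K) in min_cvg.
rewrite -(is_cvg_series_restrict K).
rewrite (_ : (fun m => \sum_(K <= k < m) a k) =
  (fun m => \sum_(K <= k < m) Num.min 1 (a k)))//.
apply/funext => m; apply: eq_big_nat => k /andP[Kk _].
have := min_lt1 k Kk; rewrite /= sub0r normrN ger0_norm ?le_min ?ler01 ?a0//.
by rewrite gt_min ltxx/= => /ltW ak; rewrite min_r.
Qed.

Lemma nneseries_EFin_lty (a : R^nat) : cvgn (series a) ->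
  (\sum_(0 <= k <oo) (a k)%:E < +oo)%E.
Proof.
move=> a_cvg.
rewrite (_ : (\sum_(0 <= k <oo) _)%E = (limn (series a))%:E) ?ltry//.
by rewrite -EFin_lim//; congr (limn _); apply/funext => m /=; rewrite sumEFin.
Qed.

Lemma divergent_window_sums (c : R^nat) (q : R -> R) :
  (forall k, c k < c k.+1) -> (forall x, exists k, x < c k) ->
  measurable_fun (`]c 0%N, +oo[ : set (LebR R)) (q : LebR R -> R) ->
  (forall r, c 0%N < r -> 0 <= q r) ->
  (forall k, exists M, forall r, c k < r <= c k.+1 -> q r <= M) ->
  (\int[mu]_(r in `]c 0%N, +oo[) (q r)%:E = +oo)%E ->
  exists rho : R^nat, (forall k, c k < rho k <= c k.+1) /\
    ~ cvgn (series (fun k => q (rho k) * (c k.+1 - c k))).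
Proof.
move=> c_lt c_unbounded mq q0 q_bounded q_int.
have c_le : {homo c : k l / (k <= l)%N >-> k <= l}.
  by apply/nondecreasing_seqP => k; exact: ltW.
have gt_c0 k r : c k < r -> c 0%N < r by exact: le_lt_trans (c_le 0%N k _).
have /choice[rho rhoP] : forall k, exists r, c k < r <= c k.+1 /\
    forall s, c k < s <= c k.+1 -> q s <= 2 * q r.
  move=> k; have [M qM] := q_bounded k.
  have [||r r_win q_le] := @exists_half_sup _ [set r | c k < r <= c k.+1] q M.
  - by exists (c k.+1); rewrite /= c_lt lexx.
  - by move=> r /= rk; rewrite qM// q0// (gt_c0 k)//; case/andP: rk.
  by exists r.
exists rho; split=> [k|sums_cvg]; first by case: (rhoP k).
have rho0 k : 0 <= q (rho k) by apply/q0/(gt_c0 k); have [/andP[]] := rhoP k.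
pose S k := 2 * q (rho k) * (c k.+1 - c k).
have S_cvg : cvgn (series S).
  rewrite (_ : S = 2 *: (fun k => q (rho k) * (c k.+1 - c k))).
    exact: is_cvg_seriesZ.
  by apply/funext => k; rewrite /S -mulrA.
have : (\int[mu]_(r in `]c 0%N, +oo[) (q r)%:E < +oo)%E; last first.
  by rewrite q_int ltxx.
rewrite integral_windows//.
apply: (@le_lt_trans _ _ (\sum_(0 <= k <oo) (S k)%:E)%E).
  apply: lee_nneseries => [k _ _|k _].
    apply: integral_ge0 => r /=; rewrite in_itv => /andP[kr _].
    by rewrite lee_fin q0// (gt_c0 k).
  apply: integral_itv_oc_le => [||r rk].
  - exact: ltW.
  - apply: measurable_funS mq; first exact: measurable_itv_LebR.
    by move=> r /=; rewrite !in_itv /= andbT => /andP[kr _]; exact: gt_c0 kr.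
  - have [_ ->//] := rhoP k; rewrite andbT q0// (gt_c0 k)//; by case/andP: rk.
exact: nneseries_EFin_lty.
Qed.

Lemma window_comparable (p kap sigma r rho : R) :
  0 < p -> 0 < sigma -> kap < sigma ->
  p <= r <= kap * p -> p <= rho <= kap * p -> rho / sigma < r < rho * sigma.
Proof.
move=> p0 sigma0 kap_lt /andP[pr rp] /andP[prho rhop].
have : kap * p < sigma * p by rewrite ltr_pM2r.
have : sigma * p <= sigma * r by rewrite ler_pM2l.
have : sigma * p <= sigma * rho by rewrite ler_pM2l.
by rewrite ltr_pdivrMr// => *; apply/andP; split; lra.
Qed.

Lemma divergent_window_weights (rs kap : R) (q : R -> R) : 0 < rs -> 1 < kap ->
  measurable_fun (`]rs, +oo[ : set (LebR R)) (q : LebR R -> R) ->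
  (forall r, rs < r -> 0 <= q r) ->
  (forall k, exists M, forall r,
     geometric rs kap k < r <= geometric rs kap k.+1 -> q r <= M) ->
  (\int[mu]_(r in `]rs, +oo[) (q r)%:E = +oo)%E ->
  exists rho w : R^nat,
    [/\ forall k, geometric rs kap k < rho k <= geometric rs kap k.+1,
      forall k, 0 <= w k <= q (rho k), forall k, w k * geometric rs kap k <= 1 &
      ~ cvgn (series (fun k => w k * geometric rs kap k))].
Proof.
move=> rs0 kap1 mq q0 q_bounded q_int.
have c_gt0 := geometric_gt0 rs0 kap1; have c_lt := geometric_lt rs0 kap1.
have := divergent_window_sums c_lt (geometric_unbounded rs0 kap1) (q := q).
rewrite geometric0 => /(_ mq q0 q_bounded q_int)[rho [rho_win rho_div]].
have qrho0 k : 0 <= q (rho k).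
  apply: q0; have /andP[+ _] := rho_win k.
  exact: le_lt_trans (geometric_ge rs0 kap1 k).
pose a k := q (rho k) * geometric rs kap k.
have a0 k : 0 <= a k by rewrite mulr_ge0// ltW.
exists rho, (fun k => Num.min 1 (a k) / geometric rs kap k).
have wE k : Num.min 1 (a k) / geometric rs kap k * geometric rs kap k =
    Num.min 1 (a k).
  by rewrite divfK// gt_eqF.
split=> // [k|k|].
- apply/andP; split; last by rewrite ler_pdivrMr// ge_min lexx orbT.
  by rewrite divr_ge0 ?le_min ?ler01 ?a0 ?(ltW (c_gt0 k)).
- by rewrite wE ge_min lexx.
under eq_fun do rewrite wE.
move/(is_cvg_series_min1 a0)/(@is_cvg_seriesZ _ _ (kap - 1)) => sums_cvg.
apply: rho_div; rewrite (_ : (fun k => _) = (kap - 1) *: a)//.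
apply/funext => k; transitivity ((kap - 1) * a k) => //.
by rewrite geometricS /a; ring.
Qed.

End WindowSelection.

Section CrossingScales.
Context {R : realType} (g : R -> R).
Notation mu := (@completed_lebesgue_measure R).

Lemma exprn_powRNV k (x : R) : (0 < k)%N -> 0 < x ->
  (x `^ (- k%:R^-1)) ^+ k = x^-1.
Proof.
move=> k0 x0; rewrite -powR_mulrn ?powR_ge0// -powRrM.
rewrite mulNr mulVf ?pnatr_eq0 -?lt0n//.
by rewrite powR_inv1// ltW.
Qed.

Hypothesis g_gt0 : forall t, 0 < t -> 0 < g t.
Hypothesis g_measurable :
  measurable_fun (`](0:R)%R, +oo[ : set (LebR R)) (g : LebR R -> R).

Let integrand t : R := (g t * t) `^ (- 4^-1).

Hypothesis integrand_lty :
  (\int[mu]_(t in `[(1:R)%R, +oo[) (integrand t)%:E < +oo)%E.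

Lemma measurable_osserman_integrand (D : set R) :
  measurable (D : set (LebR R)) -> D `<=` `](0:R)%R, +oo[ ->
  measurable_fun (D : set (LebR R)) (integrand : LebR R -> R).
Proof.
move=> mD D0; apply: (measurableT_comp (measurable_powR _)).
apply: measurable_funM; last exact: measurable_id_LebR.
by apply: measurable_funS g_measurable => //; exact: measurable_itv_LebR.
Qed.

Lemma summable_window_integrals (c : R^nat) : 1 <= c 0%N ->
  (forall k, c k < c k.+1) -> (forall x, exists k, x < c k) ->
  exists2 I : R^nat, cvgn (series I) &
    forall k, (\int[mu]_(t in `]c k, c k.+1]) (integrand t)%:E)%E = (I k)%:E.
Proof.
move=> c1 c_lt c_unbounded.
have c_le : {homo c : k l / (k <= l)%N >-> k <= l}.
  by apply/nondecreasing_seqP => k; exact: ltW.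
have h0 t : (0 <= (integrand t)%:E)%E by rewrite lee_fin powR_ge0.
pose J k := (\int[mu]_(t in `]c k, c k.+1]) (integrand t)%:E)%E.
have J0 k : (0 <= J k)%E by exact: integral_ge0.
have sumJ_fin : (\sum_(0 <= k <oo) J k < +oo)%E.
  rewrite -integral_windows//; first last.
  - by move=> t _; rewrite powR_ge0.
  - apply: measurable_osserman_integrand; first exact: measurable_itv_LebR.
    move=> t /=; rewrite !in_itv /= !andbT; apply: lt_trans.
    exact: lt_le_trans c1.
  apply: le_lt_trans integrand_lty; apply: ge0_subset_integral => //.
  - exact: measurable_itv_LebR.
  - exact: measurable_itv_LebR.
  - apply/measurable_EFinP/measurable_osserman_integrand.
      exact: measurable_itv_LebR.
    by move=> t /=; rewrite !in_itv /= !andbT; exact: lt_le_trans.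
  - by move=> t /=; rewrite !in_itv /= !andbT => /ltW; exact: le_trans.
have J_fin k : J k \is a fin_num.
  rewrite ge0_fin_numE//; apply: le_lt_trans sumJ_fin.
  apply: le_trans (nneseries_lim_ge k.+1 (fun i _ _ => J0 i)).
  by rewrite big_nat_recr//= leeDr// sume_ge0.
exists (fine \o J) => [|k]; last by rewrite /= fineK.
apply: nnseries_is_cvg => [k|]; first exact: fine_ge0.
by under eq_eseriesr do rewrite /= fineK//.
Qed.

Lemma crossing_scale_osserman (theta z lo t : R) :
  0 < lo -> 1 < z -> z < theta -> lo <= t <= z * lo ->
  crossing_scale theta g lo (z * lo) (z * lo * integrand t).
Proof.
move=> lo0 z1 z_theta t_win; have z0 := lt_trans ltr01 z1.
have [lo_t t_hi] := andP t_win; have t0 := lt_le_trans lo0 lo_t.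
have hi0 : 0 < z * lo by rewrite mulr_gt0.
have gt_gt0 : 0 < g t * t by rewrite mulr_gt0 ?g_gt0.
exists (g t); split=> //; first exact: g_gt0.
- by rewrite mulr_gt0// powR_gt0.
- move=> m m_win; exists t; split=> //.
  exact: (window_comparable lo0 (lt_trans z0 z_theta) z_theta).
rewrite [(z * lo * _) ^+ 4]exprMn (@exprn_powRNV 4)//.
rewrite (_ : _ * (_ / _) = (z * lo) ^+ 3 * (z * lo / t)).
  by rewrite ler_peMr ?exprn_ge0 ?(ltW hi0)// ler_pdivlMr ?mul1r.
by field; rewrite !gt_eqF ?g_gt0.
Qed.

Lemma summable_crossing_scales (theta z c : R) : 1 < z -> z < theta -> 1 <= c ->
  exists2 y : R^nat, cvgn (series y) & forall k,
    crossing_scale theta g (geometric c z k) (geometric c z k.+1) (y k).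
Proof.
move=> z1 z_theta c1.
have c0 := lt_le_trans ltr01 c1; have z0 := lt_trans ltr01 z1.
set lv := geometric c z.
have lv_gt0 : forall k, 0 < lv k := geometric_gt0 c0 z1.
have lv_lt : forall k, lv k < lv k.+1 := geometric_lt c0 z1.
have lvS k : lv k.+1 = z * lv k := geometricS c z k.
have lv01 : 1 <= lv 0%N by rewrite /lv geometric0.
have [I I_cvg IE] :=
  summable_window_integrals lv01 lv_lt (geometric_unbounded c0 z1).
have /choice[t tP] : forall k, exists t, lv k < t <= lv k.+1 /\
    integrand t * (lv k.+1 - lv k) <= I k.
  move=> k; have [||x x_win x_le] :=
    @exists_le_average_itv_oc _ integrand _ _ (lv_lt k).
  - apply: measurable_osserman_integrand; first exact: measurable_itv_LebR.
    by move=> x /=; rewrite !in_itv /= andbT => /andP[kx _]; exact: lt_trans kx.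
  - by move=> x _; exact: powR_ge0.
  by exists x; split=> //; rewrite -lee_fin -IE.
exists (fun k => lv k.+1 * integrand (t k)) => [|k].
  have y_ge0 k : 0 <= lv k.+1 * integrand (t k).
    by rewrite mulr_ge0 ?powR_ge0// ltW.
  have y_le k : lv k.+1 * integrand (t k) <= z / (z - 1) * I k.
    have z10 : 0 < z - 1 by rewrite subr_gt0.
    have [_ t_le] := tP k; apply: le_trans (ler_wpM2l _ t_le); last first.
      by rewrite divr_ge0// ltW.
    by rewrite lvS le_eqVlt; apply/orP; left; apply/eqP; field; rewrite gt_eqF.
  apply: series_le_cvg (@is_cvg_seriesZ _ _ (z / (z - 1)) I_cvg) => // k.
  exact: le_trans (y_ge0 k) (y_le k).
rewrite lvS; apply: crossing_scale_osserman => //.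
by have [/andP[/ltW -> +] _] := tP k; rewrite lvS.
Qed.

End CrossingScales.

Lemma ereal_inf_gt0_minorant {R : realType} (S : set R) (g : R -> R) :
  (0 < ereal_inf [set (g t)%:E | t in S])%E ->
  exists2 gam, 0 < gam & forall t, S t -> gam <= g t.
Proof.
have inf_le t : S t -> (ereal_inf [set (g t)%:E | t in S] <= (g t)%:E)%E.
  by move=> St; apply: ereal_inf_lbound; exists t.
case: (ereal_inf _) inf_le => [r| |]//= inf_le; rewrite ?lte_fin => r0.
  by exists r => // t /inf_le; rewrite lee_fin.
by exists 1 => // t /inf_le; rewrite leye_eq.
Qed.

Lemma compact_ereal_inf_minorant {R : realType} (g : R -> R) :
  (forall K : set R, compact K -> K `<=` `](0:R)%R, +oo[ ->
     (0 < ereal_inf [set (g t)%:E | t in K])%E) ->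
  forall c C, 0 < c ->
  exists2 gam, 0 < gam & forall m, c <= m <= C -> gam <= g m.
Proof.
move=> g_inf c C c0; have itv_gt0 : `[c, C] `<=` `](0:R)%R, +oo[.
  by move=> t /=; rewrite !in_itv /= andbT => /andP[/(lt_le_trans c0)].
have [gam gam0 gam_le] :=
  ereal_inf_gt0_minorant (g_inf _ (@segment_compact _ c C) itv_gt0).
by exists gam => // m mcC; apply: gam_le; rewrite /= in_itv.
Qed.

Section Vanishing.
Context {R : realType} {n : nat} (Omega : set 'rV[R]_n).
Context (f : 'rV[R]_n -> R -> R) (u : 'rV[R]_n -> R).
Context (rs sigma theta : R) (q g : R -> R).
Notation mu := (@completed_lebesgue_measure R).
Hypothesis f_gt0 : forall x t, Omega x -> 0 < t -> 0 < f x t.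
Hypothesis u_sol : nonneg_solution Omega f u.
Hypotheses (rs_gt0 : 0 < rs) (sigma1 : 1 < sigma) (theta1 : 1 < theta).
Hypothesis spheres : forall r, rs < r -> exists x, Omega x /\ enorm x = r.
Hypothesis g_minorant : forall c C, 0 < c ->
  exists2 gam, 0 < gam & forall m, c <= m <= C -> gam <= g m.
Hypothesis f_ge : forall x zeta t r, Omega x -> 0 < t -> rs < r ->
  r / sigma < enorm x < r * sigma -> t / theta < zeta < t * theta ->
  q r * g t <= f x (enorm x * zeta).

Let g_gt0 t : 0 < t -> 0 < g t.
Proof.
move=> t0; have [gam gam0 gam_le] := g_minorant t t0.
by rewrite (lt_le_trans gam0)// gam_le// lexx.
Qed.

Lemma q_bounded_on_window kap k : 1 < kap -> kap < sigma ->
  exists M, forall r,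
    geometric rs kap k < r <= geometric rs kap k.+1 -> q r <= M.
Proof.
move=> kap1 kap_sigma; have rk_lt := geometric_lt rs_gt0 kap1 k.
have rs_rk := geometric_ge rs_gt0 kap1 k.
have [x [Ox xE]] := spheres (le_lt_trans rs_rk rk_lt).
exists (f x (enorm x * 1) / g 1) => r /andP[rk_r r_rk].
rewrite ler_pdivlMr ?g_gt0//; apply: f_ge => //.
- exact: le_lt_trans rs_rk rk_r.
- have rk0 := geometric_gt0 rs_gt0 kap1 k; rewrite geometricS in r_rk rk_lt xE.
  apply: (window_comparable rk0 (lt_trans ltr01 sigma1) kap_sigma); rewrite ?xE.
    by rewrite lexx andbT ltW.
  by rewrite r_rk andbT ltW.
- by rewrite ltr_pdivrMr ?(lt_trans ltr01 theta1)// !mul1r theta1.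
Qed.

Let N := ballmax Omega u.

Lemma source_window_ge z kap k rho w r t :
  closure Omega z -> 0 < u z -> 1 < kap -> kap < sigma ->
  geometric rs kap k < rho <= geometric rs kap k.+1 -> 0 <= w <= q rho ->
  enorm z <= r -> geometric rs kap k <= r <= geometric rs kap k.+1 -> 0 < t ->
  t / theta < N r / r < t * theta -> w * g t <= source Omega f u r.
Proof.
move=> clz uz kap1 kap_sigma /andP[rk_rho rho_rk] /andP[w0 w_le].
move=> zr r_win t0 t_near.
have rk0 := geometric_gt0 rs_gt0 kap1 k; rewrite geometricS in rho_rk r_win.
have rs_rk := geometric_ge rs_gt0 kap1 k.
apply: (le_source f_gt0 u_sol clz uz zr) => x [Ox xr uxE].
have r0 : 0 < r by apply: lt_le_trans rk0 _; case/andP: r_win.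
rewrite uxE (_ : ballmax Omega u r = enorm x * (N r / r)); last first.
  by rewrite xr mulrC divfK// gt_eqF.
apply: (@le_trans _ _ (q rho * g t)); first by rewrite ler_wpM2r// ltW// g_gt0.
apply: f_ge => //; first exact: le_lt_trans rs_rk rk_rho.
rewrite xr; have sigma0 := lt_trans ltr01 sigma1.
apply: (window_comparable rk0 sigma0 kap_sigma) => //.
by rewrite rho_rk andbT ltW.
Qed.

Hypothesis q_ge0 : forall r, rs < r -> 0 <= q r.
Hypothesis q_measurable :
  measurable_fun (`]rs, +oo[ : set (LebR R)) (q : LebR R -> R).
Hypothesis q_int : (\int[mu]_(r in `]rs, +oo[) (q r)%:E = +oo)%E.
Hypothesis g_measurable :
  measurable_fun (`](0:R)%R, +oo[ : set (LebR R)) (g : LebR R -> R).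
Hypothesis g_int :
  (\int[mu]_(t in `[(1:R)%R, +oo[) ((g t * t) `^ (- 4^-1))%R%:E < +oo)%E.

Lemma solution_le0 z : closure Omega z -> u z <= 0.
Proof.
move=> clz; rewrite leNgt; apply/negP => uz.
have N_gt0 : forall r, enorm z <= r -> 0 < N r := ballmax_gt0 u_sol clz uz.
have N_lt : forall r s, enorm z <= r -> r < s -> N r < N s :=
  ballmax_lt f_gt0 u_sol clz uz.
have F_ge0 := source_ge0 f_gt0 u_sol clz uz.
have N_sub : comparison_with_parabolas N _ _ :=
  ballmax_subsolution f_gt0 u_sol clz uz.
have [kap1 kap_sigma] := midf_lt sigma1.
have [ratio1 ratio_theta] := midf_lt theta1.
set kap := (1 + sigma) / 2 in kap1 kap_sigma.
set ratio := (1 + theta) / 2 in ratio1 ratio_theta.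
have [rho [w [rho_win w_itv w_le w_div]]] := divergent_window_weights
  rs_gt0 kap1 q_measurable q_ge0
  (fun k => q_bounded_on_window k kap1 kap_sigma) q_int.
have w0 k : 0 <= w k by case/andP: (w_itv k).
pose r0 := Num.max rs (enorm z) + 1.
have rs_r0 : rs <= r0 by rewrite /r0 -[leLHS]addr0 lerD// le_max lexx.
have z_r0 : enorm z < r0.
  by rewrite /r0 -[ltLHS]addr0 ler_ltD// le_max lexx orbT.
have F_ge k r t : enorm z <= r ->
    geometric rs kap k <= r <= geometric rs kap k.+1 ->
    0 < t -> t / theta < N r / r < t * theta -> w k * g t <= source Omega f u r.
  exact: source_window_ge clz uz kap1 kap_sigma (rho_win k) (w_itv k).
apply: (no_global_growth N_lt (subsolution_convex F_ge0 N_sub) N_gt0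
  (enorm_ge0 z) z_r0 theta1 kap1 g_minorant).
  exact: (window_clocks_diverge rs_gt0 kap1 w0 w_le rs_r0 z_r0 N_lt F_ge0
    N_sub F_ge w_div).
move=> c c1; have [y y_cvg y_scale] :=
  summable_crossing_scales g_gt0 g_measurable g_int ratio1 ratio_theta c1.
exists (geometric c ratio), y; split=> //; first by rewrite geometric0.
exact: geometric_unbounded (lt_le_trans ltr01 c1) ratio1.
Qed.

End Vanishing.

Theorem theorem1 (R : realType) (n : nat) (Omega : set 'rV[R]_n) (rs : R)
  (f : 'rV[R]_n -> R -> R) (sigma theta : R) (q g : R -> R) :
  (2 <= n)%N ->
  open Omega -> connected Omega -> Omega !=set0 ->
  ~ (exists M : R, forall x, Omega x -> enorm x <= M) ->
  0 < rs ->
  (forall r, rs < r -> exists x, Omega x /\ enorm x = r) ->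
  (forall x t, Omega x -> 0 < t -> 0 < f x t) ->
  1 < sigma -> 1 < theta ->
  measurable_fun (`]rs, +oo[ : set (LebR R)) (q : LebR R -> R) -> (forall r, rs < r -> 0 <= q r) ->
  measurable_fun (`](0:R)%R, +oo[ : set (LebR R)) (g : LebR R -> R) -> (forall t, 0 < t -> 0 <= g t) ->
  (forall K : set R, compact K -> K `<=` `](0:R)%R, +oo[ ->
     (0 < ereal_inf [set (g t)%:E | t in K])%E) ->
  (forall t r, 0 < t -> rs < r ->
     (ereal_inf [set (f xz.1 (enorm xz.1 * xz.2)%R)%:E | xz in
                  [set x | Omega x /\ (r / sigma < enorm x < r * sigma)%R]
                  `*` `](t / theta)%R, (t * theta)%R[ ]
        >= (q r * g t)%:E)%E) ->
  (\int[@completed_lebesgue_measure R]_(t in `[(1:R)%R, +oo[) ((g t * t) `^ (- 4^-1))%R%:E < +oo)%E ->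
  (\int[@completed_lebesgue_measure R]_(r in `]rs, +oo[) (q r)%:E = +oo)%E ->
  forall u : 'rV[R]_n -> R, nonneg_solution Omega f u ->
  forall x, closure Omega x -> u x = 0.
Proof.
move=> _ _ _ _ _ rs_gt0 spheres f_gt0 sigma1 theta1 q_measurable q_ge0.
move=> g_measurable _ g_inf f_inf g_int q_int u u_sol x clx.
have f_ge y zeta t r : Omega y -> 0 < t -> rs < r ->
    r / sigma < enorm y < r * sigma -> t / theta < zeta < t * theta ->
    q r * g t <= f y (enorm y * zeta).
  move=> Oy t0 rsr yr zeta_t.
  rewrite -lee_fin; apply: le_trans (f_inf t r t0 rsr) _.
  by apply: ereal_inf_lbound; exists (y, zeta).
have [u_ge0 _] := u_sol; apply/le_anti; rewrite u_ge0// andbT.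
exact: (solution_le0 f_gt0 u_sol rs_gt0 sigma1 theta1 spheres
  (compact_ereal_inf_minorant g_inf) f_ge q_ge0 q_measurable q_int
  g_measurable g_int clx).
Qed.
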